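(* Let $v\le w$ in the Bruhat order on $S_n$, $r=\ell(w)-\ell(v)$, and let $\Psi_{v,w}:\mathcal R^{>0}_{v,w}\to\mathbb R^r$ be the map sending the flag represented by $M_{v,w}(\mathbf a)$ to $\mathbf a$. Let $\mathcal E$ be the set of extremal indices of $P(M_{v,w}(\mathbf a))$ (which does not depend on $\mathbf a\in\mathbb R^r_{>0}$). Then each coordinate of $\Psi_{v,w}$ is a Laurent monomial in the extremal Plücker coordinates: for each $j\in[k]\setminus J$ there is a Laurent monomial $m_j$ in variables $(p_I)_{I\in\mathcal E}$ such that $a_j=m_j\big((P_I(M_{v,w}(\mathbf a)))_{I\in\mathcal E}\big)$ for all $\mathbf a\in\mathbb R^r_{>0}$.
   Context: Permutations: $s_i=(i,i+1)\in S_n$; $\ell$ is length; $\le$ the Bruhat order. Given a reduced expression $s_{i_1}\cdots s_{i_k}$ of $w$ and $v\le w$, a subexpression for $v$ is given by positions $j_1<\dots<j_m$ with $s_{i_{j_1}}\cdots s_{i_{j_m}}=v$; it is positive distinguished if it is reduced and for every position $p\notin\{j_1,\dots,j_m\}$, with $u_p$ the product of the $s_{i_{j_t}}$ with $j_t>p$ (in order), $\ell(s_{i_p}u_p)>\ell(u_p)$; such a subexpression exists and is unique. For $1\le k<n$, $x_k(a)$ is the identity with an extra entry $a$ in row $k$, column $k+1$; $\dot s_k$ is the identity with the block in rows/columns $\{k,k+1\}$ replaced by $\begin{pmatrix}0&1\\-1&0\end{pmatrix}$. Fix $w_0=(s_1\cdots s_{n-1})(s_1\cdots s_{n-2})\cdots(s_1s_2)(s_1)$.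 For $v\le w$, let $s_{i_1}\cdots s_{i_k}$ ($k=\ell(w)$) be the positive distinguished subexpression for $w$ in it, $J\subset[k]$ the positions of the positive distinguished subexpression for $v$ in it, and for $\mathbf a=(a_j)_{j\in[k]\setminus J}\in\mathbb R_{>0}^{r}$ put $M_{v,w}(\mathbf a)=M_1\cdots M_k$, $M_j=\dot s_{i_j}$ for $j\in J$, $M_j=x_{i_j}(a_j)$ otherwise. $\mathcal R^{>0}_{v,w}$ is the set of complete flags (first $i$ rows spanning $V_i$) represented by the matrices $M_{v,w}(\mathbf a)$, $\mathbf a\in\mathbb R^r_{>0}$; $\mathbf a\mapsto$ flag is injective. $P_I(M)$ is the determinant of the submatrix of $M$ in rows $\{1,\dots,|I|\}$ and columns $I$. Extremal indices: for $P=(P_I)$ with $I$ ranging over subsets with $1\le|I|\le n-1$, and $1\le k<n$, define $\Xi_P$ on $k$-subsets: if $P_I\ne0$, let $b$ be the largest $i\in I$ such that there is $j\notin I$, $j>i$, with $P_{(I\setminus\{i\})\cup\{j\}}\ne0$; if $b$ exists, let $a$ be the largest $j\notin I$ with $P_{(I\setminus\{b\})\cup\{j\}}\ne0$ and set $\Xi_P(I)=(I\setminus\{b\})\cup\{a\}$; otherwise ($P_I=0$ or no such $b$) $\Xi_P(I)=I$. The Gale order on $k$-subsets: $\{i_1<\dots<i_k\}\le\{j_1<\dots<j_k\}$ iff $i_t\le j_t$ for all $t$. Let $I_k$ be the Gale-minimal $k$-subset with $P_{I_k}\ne0$ (it exists and is unique when the nonzero indices form a matroid). The extremal indices of $P$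 are the subsets in the $\Xi_P$-orbit $\{I_k,\Xi_P(I_k),\Xi_P^2(I_k),\dots\}$ for some $k\in[n-1]$; the corresponding $P_I$ are the extremal (non-zero) Plücker coordinates. *)

(* Defs.v *)
From HB Require Import structures.
From mathcomp Require Import all_boot all_order all_algebra fingroup perm.
Set Implicit Arguments. Unset Strict Implicit. Unset Printing Implicit Defensive.
Import Order.TTheory GRing.Theory Num.Theory.
Local Open Scope ring_scope.

Section Defs.
Variable n : nat.

(* Points 1..n of the paper are the ordinals 0..n-1 of 'I_n.                *)
(* (MathComp's product satisfies (g * f) x = f (g x).)                       *)
Definition comp (f g : 'S_n) : 'S_n := (g * f)%g.

(* simple transposition s_i = (i, i+1), 1 <= i < n  (identity otherwise) *)
Definition sref (i : nat) : 'S_n :=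
  match @insub _ (fun k => k < n)%N _ i.-1, @insub _ (fun k => k < n)%N _ i with
  | Some a, Some b => if (0 < i)%N then tperm a b else 1%g
  | _, _ => 1%g
  end.

Fixpoint wprod (u : seq nat) : 'S_n :=
  if u is i :: l then comp (sref i) (wprod l) else 1%g.

Definition len (w : 'S_n) : nat :=
  #|[set p : 'I_n * 'I_n | (p.1 < p.2)%N && (w p.2 < w p.1)%N]|.

Definition bruhat_step : rel 'S_n := fun x y =>
  [exists t : 'I_n * 'I_n, (t.1 != t.2) && (y == comp x (tperm t.1 t.2))]
  && (len x < len y)%N.
Definition bruhat_le (v w : 'S_n) : bool := connect bruhat_step v w.

(* positive distinguished subexpression for x in the word u, given by the
   mask m (selected positions = positions j_1 < ... < j_m) *)
Definition later_prod (u : seq nat) (m : bitseq) (p : nat) : 'S_n :=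
  wprod (mask (drop p.+1 m) (drop p.+1 u)).
Definition is_pds (u : seq nat) (x : 'S_n) (m : bitseq) : bool :=
  [&& size m == size u,
      wprod (mask m u) == x,
      size (mask m u) == len x
    & all (fun p => nth false m p ||
             (len (later_prod u m p) < len (comp (sref (nth 0%N u p)) (later_prod u m p)))%N)
          (iota 0 (size u))].

(* the fixed reduced word of w_0 = (s_1...s_{n-1})(s_1...s_{n-2})...(s_1 s_2)(s_1) *)
Definition w0word : seq nat :=
  flatten [seq iota 1 (n.-1 - t) | t <- iota 0 n.-1].

Variable R : realFieldType.

(* x_k(a): identity plus entry a in row k, column k+1 (1-based) *)
Definition xmat (k : nat) (a : R) : 'M[R]_n :=
  \matrix_(i < n, j < n)
    ((i == j :> nat)%:R + (if ((i : nat) == k.-1) && ((j : nat) == k) then a else 0)).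

Definition sdot (k : nat) : 'M[R]_n :=
  \matrix_(i < n, j < n)
    (if ((i : nat) == k.-1) && ((j : nat) == k.-1) then 0
     else if ((i : nat) == k.-1) && ((j : nat) == k) then 1
     else if ((i : nat) == k) && ((j : nat) == k.-1) then -1
     else if ((i : nat) == k) && ((j : nat) == k) then 0
     else (i == j :> nat)%:R).

(* M = M_1 ... M_k  for the word u, mask J (positions of v's subexpression)
   and parameters a (only the values at positions outside J are used) *)
Definition Mword (u : seq nat) (J : bitseq) (a : nat -> R) : 'M[R]_n :=
  foldr (fun p acc =>
           (if nth false J p then sdot (nth 0%N u p) else xmat (nth 0%N u p) (a p)) *m acc)
        1%:M (iota 0 (size u)).

Lemma card_set_le (I : {set 'I_n}) : (#|I| <= n)%N.
Proof. by rewrite -[X in (_ <= X)%N](card_ord n) max_card. Qed.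

(* P_I(M): minor in rows 1..|I| and columns I (enum I lists I increasingly) *)
Definition pluck (M : 'M[R]_n) (I : {set 'I_n}) : R :=
  \det (\matrix_(r < #|I|, c < #|I|) M (widen_ord (card_set_le I) r) (enum_val c)).

Variable P : {set 'I_n} -> R.

Definition setmax (B : {set 'I_n}) : option 'I_n :=
  [pick i in B | [forall j in B, (j <= i)%N]].

Definition Xi (I : {set 'I_n}) : {set 'I_n} :=
  if P I == 0 then I else
  match setmax [set i in I | [exists j : 'I_n,
          [&& j \notin I, (i < j)%N & P ((I :\ i) :|: [set j]) != 0]]] with
  | None => I
  | Some b =>
    match setmax [set j | (j \notin I) && (P ((I :\ b) :|: [set j]) != 0)] with
    | None => I
    | Some a => (I :\ b) :|: [set a]
    end
  end.

Definition gale_le (I J : {set 'I_n}) : bool :=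
  (#|I| == #|J|) && all2 (fun x y => (x <= y)%N) (map val (enum I)) (map val (enum J)).

Definition gale_min (k : nat) (I : {set 'I_n}) : bool :=
  [&& #|I| == k, P I != 0 &
      [forall J : {set 'I_n}, ((#|J| == k) && (P J != 0)) ==> gale_le I J]].

Definition extremal (I : {set 'I_n}) : Prop :=
  exists k : nat, [/\ (1 <= k)%N, (k <= n.-1)%N &
    exists Ik, gale_min k Ik /\ exists t : nat, I = iter t Xi Ik].

End Defs.

(* Main.v *)
(** Group the reduced word of w0 into the blocks (s_1 ... s_q), q = n-1, ..., 1,
    so that M = A N with A the product of the letters in the first block. A
    block acts on the one-line notations x of v^-1 and y of w^-1 as one pass of
    bubble sort: a value is carried across the positions, b_k for v and c_k for
    w. If r_k is the row k of the product of N with the letters of the block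
    from position k on, Laplace expansion along r_k expresses the Plücker
    coordinates of M with k+1 columns by those of N with k columns:
      P_(J+c)(M) = r_k(c) P_J(N) for c = c_k, and
      P_(J+b)(M) = P_J(N) for b = b_k as long as J agrees below b with the
      Gale-minimal basis.
    Hence, if J_0, J_1, ... is the Xi-orbit of N with k columns, the orbit of M
    with k+1 columns is J_0+b, ..., J_t+b, J_t+c, J_(t+1)+c, ..., where t is the
    first step that stops or moves an element smaller than b (and it is J_0+c,
    J_1+c, ... if b = c). So every extremal coordinate of N, and every r_k(c_k),
    is a Laurent monomial in extremal coordinates of M. Since
    r_k(c_k) = a r_(k+1)(c_(k+1)) when letter k is x_k(a), the parameters of the
    block are Laurent monomials as well, and one concludes by induction on the
    number of blocks.

    Rows, columns and letters are numbered from 0, so that the letter k is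
    s_(k+1) and mixes the rows k and k+1. *)
Require Import Defs.
From mathcomp Require Import all_boot all_order all_algebra fingroup perm zify ring.
Set Implicit Arguments. Unset Strict Implicit. Unset Printing Implicit Defensive.
Import Order.TTheory GRing.Theory Num.Theory.
Local Open Scope ring_scope.
(* The name [comp] is shadowed by function composition. *)
Local Notation pcomp := Defs.comp.

(** * The exchange map *)

Section Exchange.
Variables (n : nat) (R : realFieldType).
Implicit Types (P Q : {set 'I_n} -> R) (I J : {set 'I_n}) (i j a b : 'I_n).

Variant setmax_spec (B : {set 'I_n}) : option 'I_n -> Prop :=
| SetmaxSome i of i \in B & (forall j, j \in B -> (j <= i)%N) : setmax_spec B (Some i)
| SetmaxNone of B = set0 : setmax_spec B None.

Lemma setmaxP (B : {set 'I_n}) : setmax_spec B (setmax B).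
Proof.
rewrite /setmax; case: pickP => [i /andP[iB /forall_inP mx]|no].
  exact: SetmaxSome.
apply: SetmaxNone; apply/eqP/set0Pn => -[i0 i0B].
case: (arg_maxnP (fun i : 'I_n => i : nat) i0B) => i iB mx.
by case/negP: (negbT (no i)); apply/andP; split=> //; apply/forall_inP => j /mx.
Qed.

Definition movable P I i j :=
  [/\ i \in I, j \notin I, (i < j)%N & P ((I :\ i) :|: [set j]) != 0].

(** A relational form of the two choices made by [Xi]. As in [Xi], the last clause ranges over all
    [j] outside [I], also those before [b]; the maximum still exceeds [b] because some admissible
    [j] does. *)
Definition top_move P I b a :=
  [/\ movable P I b a,
      forall i j, movable P I i j -> (i <= b)%N &
      forall j, j \notin I -> P ((I :\ b) :|: [set j]) != 0 -> (j <= a)%N].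

Lemma top_move_uniq P I b a b' a' :
  top_move P I b a -> top_move P I b' a' -> b = b' /\ a = a'.
Proof.
move=> [m1 b1 a1] [m2 b2 a2].
have ebb : b = b' by apply/val_inj/eqP; rewrite eqn_leq (b2 _ _ m1) (b1 _ _ m2).
subst b'; split=> //; case: m1 m2 => [_ u1 _ v1] [_ u2 _ v2].
by apply/val_inj/eqP; rewrite eqn_leq (a2 _ u1 v1) (a1 _ u2 v2).
Qed.

Variant Xi_spec P I : {set 'I_n} -> Prop :=
| XiMove b a of top_move P I b a : Xi_spec P I ((I :\ b) :|: [set a])
| XiStay of (forall i j, ~ movable P I i j) : Xi_spec P I I.

Lemma XiP P I : P I != 0 -> Xi_spec P I (Xi P I).
Proof.
rewrite /Xi => /negbTE ->.
case: setmaxP => [b|B0]; last first.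
  apply: XiStay => i j [iI jI ij Pij].
  have := in_set0 i; rewrite -B0 inE iI => /existsP; case.
  by exists j; rewrite jI ij Pij.
rewrite inE => /andP[bI /existsP[j0 /and3P[j0I bj0 Pj0]]] bmax.
case: setmaxP => [a|A0]; last by have := in_set0 j0; rewrite -A0 inE j0I Pj0.
rewrite inE => /andP[aI Pa] amax; apply: XiMove.
have ja: (j0 <= a)%N by apply: amax; rewrite inE j0I.
split; first by split=> //; apply: leq_trans bj0 ja.
  move=> i j [iI jI ij Pij]; apply: bmax; rewrite inE iI.
  by apply/existsP; exists j; rewrite jI ij.
by move=> j jI Pj; apply: amax; rewrite inE jI.
Qed.

Lemma Xi_top_move P I b a :
  P I != 0 -> top_move P I b a -> Xi P I = (I :\ b) :|: [set a].
Proof.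
move=> /XiP[b' a' mv' mv|st [m _ _]]; last by case: (st b a).
by case: (top_move_uniq mv mv') => -> ->.
Qed.

Lemma Xi_stay P I : P I != 0 -> (forall i j, ~ movable P I i j) -> Xi P I = I.
Proof. by move=> /XiP[b a [m _ _] st|//]; case: (st b a). Qed.

Lemma Xi_neq0 P I : P I != 0 -> P (Xi P I) != 0.
Proof. by move=> PI; case: (XiP PI) => // b a [[]]. Qed.

Lemma card_exchange I i j : i \in I -> j \notin I -> #|(I :\ i) :|: [set j]| = #|I|.
Proof.
move=> iI jI; rewrite setUC cardsU1 !inE negb_and jI orbT /=.
by rewrite [in RHS](cardsD1 i) iI.
Qed.

Lemma card_Xi P I : #|Xi P I| = #|I|.
Proof.
have [P0|PI] := eqVneq (P I) 0; first by rewrite /Xi P0 eqxx.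
by case: (XiP PI) => // b a [[bI aI _ _] _ _]; rewrite card_exchange.
Qed.

Lemma sum_exchange I i j : i \in I -> j \notin I ->
  (\sum_(l in (I :\ i) :|: [set j]) (l : nat) + i = \sum_(l in I) (l : nat) + j)%N.
Proof.
move=> iI jI; rewrite setUC big_setU1 /=; last by rewrite !inE negb_and jI orbT.
by rewrite [in RHS](big_setD1 i) //= addnC (addnC (j : nat)) addnA.
Qed.

(* Each proper step raises the sum of the elements, so the orbit stabilizes. *)
Lemma Xi_orbit_stable P I : exists t, iter t.+1 (Xi P) I = iter t (Xi P) I.
Proof.
pose S (A : {set 'I_n}) := (\sum_(l in A) (l : nat))%N.
have SB A : (S A <= n * n)%N.
  rewrite /S; apply: leq_trans (_ : \sum_(l in A) n <= _)%N.
    by apply: leq_sum => l _; apply: ltnW.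
  by rewrite sum_nat_const leq_mul2r card_set_le orbT.
(* The measure is the room left below the bound: at most n elements, each smaller than n. *)
have [m] := ubnP (n * n - S I)%N; elim: m I => // m IH I lem.
have [e|ne] := eqVneq (Xi P I) I; first by exists 0%N.
have SX : (S I < S (Xi P I))%N.
  have [P0|PI] := eqVneq (P I) 0; first by move: ne; rewrite /Xi P0 !eqxx.
  move: ne; case: (XiP PI) => [b a [[bI aI ba _] _ _] _|_]; last by rewrite eqxx.
  by rewrite -(ltn_add2r b) /S sum_exchange // ltn_add2l.
have [|t e] := IH (Xi P I).
  rewrite -ltnS; apply: leq_trans lem; rewrite ltnS ltn_sub2l //.
  by apply: leq_trans SX (SB _).
by exists t.+1; rewrite !(iterSr _ _ I).
Qed.

End Exchange.

(** * Comparing the coordinates with k and k+1 columns *)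

Section Level.
Variables (n : nat) (R : realFieldType).
Implicit Types (I J : {set 'I_n}) (i j : 'I_n).

(** The sizes of these sets encode the Gale order: for sets of equal size, [I] precedes [J] exactly
    when [#|upto J t| <= #|upto I t|] for all [t]. The size of [above] gives the Laplace sign of a
    column. *)
Definition upto I (t : nat) := [set i in I | (i <= t)%N].
Definition below I (t : nat) := [set i in I | (i < t)%N].
Definition above I (t : nat) := [set i in I | (t < i)%N].

Lemma card_upto_above I t : (#|upto I t| + #|above I t|)%N = #|I|.
Proof.
rewrite -(cardsID [set i : 'I_n | (i <= t)%N] I); congr (_ + _)%N; apply: eq_card => i.
  by rewrite !inE.
by rewrite !inE -ltnNge andbC.
Qed.

Lemma uptoU1 I j t : j \notin I -> #|upto (j |: I) t| = ((j <= t)%N + #|upto I t|)%N.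
Proof.
move=> jI; have [jt|tj] /= := leqP j t.
  rewrite (_ : upto _ t = j |: upto I t) ?cardsU1 ?inE ?(negbTE jI) //.
  by apply/setP => i; rewrite !inE andb_orl; have [->|] := eqVneq i j; rewrite ?jt.
apply: eq_card => i; rewrite !inE andb_orl.
by have [->|] := eqVneq i j; rewrite ?(leqNgt j t) ?tj //= andbF.
Qed.

Lemma upto_below I j : j \notin I -> upto I j = below I j.
Proof.
move=> jI; apply/setP => i; rewrite !inE leq_eqVlt.
by have [/val_inj->|] //= := eqVneq (i : nat) j; rewrite (negbTE jI).
Qed.

Lemma exchangeU1 I i j l : l \notin I -> l != i ->
  ((l |: I) :\ i) :|: [set j] = l |: ((I :\ i) :|: [set j]).
Proof.
move=> lI li; apply/setP => h; rewrite !inE.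
by have [->|] //= := eqVneq h l; rewrite li.
Qed.

(* [Q] stands for the coordinates of N with [k] columns, [P] for those of M with
   [k.+1] columns, [r] for the row r_k, and [J0] for the Gale-minimal basis of [Q]. *)
Variables (Q P : {set 'I_n} -> R) (r : 'I_n -> R) (k : nat) (J0 : {set 'I_n}) (b c : 'I_n).
Hypothesis expand : forall I, #|I| = k.+1 ->
  P I = \sum_(j in I) (-1) ^+ #|above I j| * r j * Q (I :\ j).
Hypothesis Qtop : forall J, #|J| = k -> Q J != 0 -> forall j, j \in J -> (j < c)%N.
Hypothesis Qlow : forall J, #|J| = k -> Q J != 0 -> forall t, (#|upto J t| <= #|upto J0 t|)%N.
Hypothesis r_low : forall j, r j != 0 -> (b <= j)%N.
Hypothesis r_top : forall j, r j != 0 -> (j <= c)%N.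
(** This is the Laplace sign of the column [b] in [b |: J0], so the two signs cancel in the
    expansion. *)
Hypothesis rb : r b = (-1) ^+ #|above J0 b|.
Hypothesis rc : r c != 0.
Hypothesis cardJ0 : #|J0| = k.
Hypothesis bJ0 : b \notin J0.
Hypothesis QJ0 : Q J0 = 1.

(** A nonzero Laplace sum has a nonzero term; this reduces questions on the support of [P] to the
    supports of [Q] and [r]. *)
Lemma level_term I : #|I| = k.+1 -> P I != 0 ->
  exists j, [/\ j \in I, #|I :\ j| = k, r j != 0 & Q (I :\ j) != 0].
Proof.
move=> Ik PI.
have [j] : exists j, (j \in I) && (r j * Q (I :\ j) != 0).
  apply/existsP; apply: contraNT PI => /existsPn no.
  rewrite expand // big1 // => j jI; have := no j.
  rewrite jI /= negbK -mulrA. by move=> /eqP->; rewrite mulr0.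
rewrite mulf_eq0 negb_or => /and3P[jI rj Qj]; exists j; split=> //.
by move: Ik; rewrite (cardsD1 j) jI add1n => -[].
Qed.

Lemma level_top I : #|I| = k.+1 -> P I != 0 -> forall i, i \in I -> (i <= c)%N.
Proof.
move=> Ik PI i iI; have [j [jI cj rj Qj]] := level_term Ik PI.
have [->|ij] := eqVneq i j; first exact: r_top.
by apply: ltnW; apply: Qtop Qj _ _ => //; rewrite !inE ij.
Qed.

Lemma level_low I : #|I| = k.+1 -> P I != 0 ->
  forall t, (#|upto I t| <= #|upto (b |: J0) t|)%N.
Proof.
move=> Ik PI t; have [j [jI cj rj Qj]] := level_term Ik PI.
rewrite -(setD1K jI) !uptoU1 ?setD11 //.
apply: leq_add; last exact: Qlow.
by have := r_low rj; case: (leqP j t) => // jt bj; rewrite (leq_trans bj jt).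
Qed.

(** Every term that deletes a column other than [c] keeps [c], so its minor vanishes by [Qtop]. The
    remaining term has sign +1, as nothing in [J] lies beyond [c] when [Q J] is nonzero. *)
Lemma level_c J : #|J| = k -> c \notin J -> P (c |: J) = r c * Q J.
Proof.
move=> Jk cJ; have Ik : #|c |: J| = k.+1 by rewrite cardsU1 cJ Jk.
rewrite expand // big_setU1 //= big1 ?addr0 => [|j jJ].
  rewrite setU1K //; have [->|QJ] := eqVneq (Q J) 0; first by rewrite !mulr0.
  rewrite (_ : above _ _ = set0) ?cards0 ?expr0 ?mul1r //.
  apply/setP => i; rewrite !inE; apply/negP => /andP[/orP[/eqP->|iJ]]; first by rewrite ltnn.
  by rewrite ltnNge ltnW // (Qtop Jk).
have jc : j != c by apply: contraNneq cJ => <-.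
have [->|Qj] := eqVneq (Q ((c |: J) :\ j)) 0; first by rewrite mulr0.
have := Qtop _ Qj (j := c); rewrite ltnn => H; suff: false by [].
apply: H; last by rewrite !inE eq_sym jc eqxx.
by move: Ik; rewrite (cardsD1 j) inE jJ orbT add1n => -[].
Qed.

(** A nonzero entry [r j] with [j] other than [b] has [b < j], so deleting [j] leaves one element
    more up to [b] than [J0] has, against [Qlow]. In the term of [b] the sign squares to 1, since
    [J] and [J0] have equally many elements above [b]. *)
Lemma level_b J : #|J| = k -> b \notin J -> below J b = below J0 b -> P (b |: J) = Q J.
Proof.
move=> Jk bJ eJ; have Ik : #|b |: J| = k.+1 by rewrite cardsU1 bJ Jk.
rewrite expand // big_setU1 //= big1 ?addr0 => [|j jJ].
  rewrite setU1K // rb.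
  have -> : #|above (b |: J) b| = #|above J b|.
    by apply: eq_card => i; rewrite !inE andb_orl; have [->|] //= := eqVneq i b; rewrite ltnn (negbTE bJ).
  have -> : #|above J b| = #|above J0 b|.
    apply/eqP; rewrite -(eqn_add2l #|upto J b|) card_upto_above.
    by rewrite upto_below // eJ -upto_below // card_upto_above Jk cardJ0.
  by rewrite -expr2 -exprM muln2 -signr_odd odd_double mul1r.
have jb : j != b by apply: contraNneq bJ => <-.
have [->|rj] := eqVneq (r j) 0; first by rewrite mulr0 mul0r.
have bj : (b < j)%N by rewrite ltn_neqAle r_low // andbT eq_sym.
have [->|Qj] := eqVneq (Q ((b |: J) :\ j)) 0; first by rewrite mulr0.
have : (#|upto ((b |: J) :\ j) b| <= #|upto J0 b|)%N.
  by apply: Qlow => //; move: Ik; rewrite (cardsD1 j) inE jJ orbT add1n => -[].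
suff -> : #|upto ((b |: J) :\ j) b| = #|upto (b |: J) b|.
  by rewrite uptoU1 // leqnn upto_below // eJ upto_below // ltnn.
apply: eq_card => i; rewrite !inE; have [->|//] := eqVneq i j.
by rewrite (negbTE jb) jJ /= leqNgt bj.
Qed.

Lemma level_min : P (b |: J0) = 1.
Proof. by rewrite level_b. Qed.

Lemma b_le_c : (b <= c)%N.
Proof.
apply: (@level_top (b |: J0)); rewrite ?setU11 //; last by rewrite level_min oner_eq0.
by rewrite cardsU1 bJ0 cardJ0.
Qed.

Lemma below_exchange J i j : i \in J -> (b < i)%N -> (b < j)%N ->
  below ((J :\ i) :|: [set j]) b = below J b.
Proof.
move=> iJ bi bj; apply/setP => h; rewrite !inE.
have [->|_] := eqVneq h j; first by rewrite orbT /= !ltnNge ltnW //= andbF.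
by have [->|_] := eqVneq h i; rewrite ?orbF //= ltnNge ltnW //= andbF.
Qed.

Lemma c_notin J : #|J| = k -> Q J != 0 -> c \notin J.
Proof. by move=> Jk QJ; apply/negP => /(Qtop Jk QJ); rewrite ltnn. Qed.

Lemma movable_addc J i j : #|J| = k -> c \notin J -> i != c -> j != c ->
  movable P (c |: J) i j <-> movable Q J i j.
Proof.
move=> Jk cJ ic jc; rewrite /movable !inE (negbTE ic) (negbTE jc) /=.
split=> -[iJ jJ ij].
  rewrite exchangeU1 //; last by rewrite eq_sym.
  rewrite level_c ?card_exchange //; last by rewrite !inE negb_or negb_and cJ orbT eq_sym.
  by rewrite mulf_eq0 negb_or => /andP[].
move=> Qn; split=> //; rewrite exchangeU1 //; last by rewrite eq_sym.
rewrite level_c ?card_exchange //; last by rewrite !inE negb_or negb_and cJ orbT eq_sym.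
by rewrite mulf_neq0.
Qed.

Lemma Xi_addc J : #|J| = k -> Q J != 0 -> Xi P (c |: J) = c |: Xi Q J.
Proof.
move=> Jk QJ; have cJ := c_notin Jk QJ.
have PcJ : P (c |: J) != 0 by rewrite level_c // mulf_neq0.
have Ik : #|c |: J| = k.+1 by rewrite cardsU1 cJ Jk.
have mvlt i j : movable P (c |: J) i j -> i != c /\ j != c.
  move=> [iI jI ij Pij]; split; last by apply: contraNneq jI => ->; rewrite setU11.
  apply: contraTneq ij => ->; rewrite -leqNgt.
  by apply: (@level_top (((c |: J) :\ i) :|: [set j])); rewrite ?card_exchange // !inE eqxx orbT.
have Qlt i j : movable Q J i j -> i != c /\ j != c.
  move=> [iI jI ij Qij].
  have jc : (j < c)%N by apply: (Qtop _ Qij); rewrite ?card_exchange // !inE eqxx orbT.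
  split; apply: contraTneq jc => e; rewrite -leqNgt -e //.
  exact: ltnW.
have eqm i j : movable P (c |: J) i j <-> movable Q J i j.
  split=> m; [have [] := mvlt _ _ m|have [] := Qlt _ _ m]; move=> ic jc;
    by apply/(movable_addc Jk cJ ic jc).
case: (XiP QJ) => [b' a' [m bm am]|st]; last first.
  by apply: Xi_stay => // i j /eqm; apply: st.
have [bc ac] := Qlt _ _ m; rewrite (@Xi_top_move _ _ P _ b' a') //.
  by rewrite exchangeU1 // eq_sym.
split; [exact/eqm|by move=> i j /eqm; apply: bm|].
move=> j; rewrite !inE negb_or => /andP[jc jJ].
have [b'J _ _ _] := m; have cb' : c != b' by rewrite eq_sym.
rewrite exchangeU1 // level_c ?card_exchange //; last first.
  by rewrite !inE negb_or negb_and cJ orbT eq_sym.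
by rewrite mulf_eq0 negb_or => /andP[_]; apply: am.
Qed.

Section Addb.
Variable J : {set 'I_n}.
Hypotheses (bc : (b < c)%N) (Jk : #|J| = k) (QJ : Q J != 0) (bJ : b \notin J).
Hypothesis eJ : below J b = below J0 b.

Lemma addb_neq0 : P (b |: J) != 0.
Proof. by rewrite level_b. Qed.

Lemma addb_exchange i j : i \in J -> j \notin J -> (b < i)%N -> (b < j)%N ->
  P (((b |: J) :\ i) :|: [set j]) = Q ((J :\ i) :|: [set j]).
Proof.
move=> iJ jJ bi bj; rewrite exchangeU1 //; last by apply: contraNneq bJ => ->.
rewrite level_b // ?card_exchange //; last by rewrite below_exchange.
by rewrite !inE negb_or negb_and bJ orbT -(inj_eq val_inj) /= neq_ltn bj.
Qed.

Lemma movable_addb i j : (b < i)%N -> movable P (b |: J) i j <-> movable Q J i j.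
Proof.
move=> bi; rewrite /movable !inE.
have ib : i != b by rewrite -(inj_eq val_inj) neq_ltn bi orbT.
rewrite (negbTE ib) /=; split=> -[iJ].
  rewrite negb_or => /andP[jb jJ ij]; rewrite addb_exchange //.
  exact: ltn_trans bi ij.
move=> jJ ij Qij; have bj := ltn_trans bi ij.
by rewrite negb_or -(inj_eq val_inj) /= neq_ltn bj orbT jJ addb_exchange.
Qed.

(** The step of [Q] takes place above [b], where [level_b] identifies the exchanges of [P] and [Q];
    so it is also the top move of [P]. *)
Lemma Xi_addb_follow : Xi Q J != J -> below (Xi Q J) b = below J b ->
  b \notin Xi Q J /\ Xi P (b |: J) = b |: Xi Q J.
Proof.
case: (XiP QJ) => [b' a' [m bm am] _ eX|]; last by rewrite eqxx.
case: (m) => b'J a'J b'a' _.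
(* Removing an element smaller than [b] would change the part below [b], since its replacement is a
   different, larger element. *)
have bb' : (b < b')%N.
  rewrite ltn_neqAle leqNgt; apply/andP; split.
    by apply: contraNneq bJ => /val_inj->.
  apply/negP => b'b; have : b' \in below J b by rewrite inE b'J.
  by rewrite -eX !inE eqxx /= => /andP[/eqP e _]; rewrite -e ltnn in b'a'.
have ba' := ltn_trans bb' b'a'.
split; first by rewrite !inE negb_or negb_and bJ orbT -(inj_eq val_inj) /= neq_ltn ba'.
rewrite (@Xi_top_move _ _ P _ b' a') ?addb_neq0 //.
  by rewrite exchangeU1 // -(inj_eq val_inj) /= neq_ltn bb'.
split; first exact/movable_addb.
  move=> i j mi; have [ib|bi] := leqP i b; first exact: leq_trans ib (ltnW bb').
  by apply: (bm i j); apply/movable_addb.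
move=> j; rewrite !inE negb_or => /andP[jb jJ].
have [lejb _|bj] := leqP j b; first exact: leq_trans lejb (ltnW ba').
by rewrite addb_exchange //; apply: am.
Qed.

(** Nothing above [b] can move, so [b] is the largest movable element; [c] is an admissible target
    by [level_c] and the largest one by [level_top]. *)
Lemma Xi_addb_jump : Xi Q J = J \/ below (Xi Q J) b != below J b ->
  Xi P (b |: J) = c |: J.
Proof.
move=> H; have cJ := c_notin Jk QJ.
(* [Xi] moves the largest movable element, so a movable [i] above [b] would force a proper step that
   leaves the part below [b] intact. *)
have nom i j : (b < i)%N -> ~ movable Q J i j.
  move=> bi mi; case: H.
    case: (XiP QJ) => [b' a' [[b'J a'J _ _] _ _]|/(_ i j) //].
    by move/setP/(_ a'); rewrite !inE eqxx orbT (negbTE a'J).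
  case: (XiP QJ) => [b' a' [m bm am]|/(_ i j) //].
  case: (m) => b'J _ b'a' _; have bb' := leq_trans bi (bm _ _ mi).
  by rewrite below_exchange ?eqxx // (ltn_trans bb' b'a').
have cb : c != b by rewrite -(inj_eq val_inj) neq_ltn bc orbT.
have ex j : ((b |: J) :\ b) :|: [set j] = j |: J by rewrite setU1K // setUC.
rewrite (@Xi_top_move _ _ P _ b c) ?addb_neq0 ?ex //; split.
- split; rewrite ?setU11 // ?ex ?level_c ?mulf_neq0 //.
  by rewrite !inE negb_or cb.
- by move=> i j mi; rewrite leqNgt; apply/negP => bi; apply: (nom i j bi); apply/movable_addb.
move=> j; rewrite !inE negb_or ex => /andP[_ jJ] Pj.
by apply: (@level_top (j |: J)); rewrite ?setU11 // cardsU1 jJ Jk.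
Qed.

End Addb.
End Level.

(** * Laurent monomials *)

Section Monomials.
Variables (A : Type) (R : realFieldType) (D : A -> Prop).

(** Laurent monomials as a closure, with functions identified when they agree on [D]. Exponents are
    extracted only at the end. *)
Inductive monomial (G : (A -> R) -> Prop) : (A -> R) -> Prop :=
| mono_gen g : G g -> monomial G g
| mono_one : monomial G (fun=> 1)
| mono_mul f g : monomial G f -> monomial G g -> monomial G (fun a => f a * g a)
| mono_inv f : monomial G f -> monomial G (fun a => (f a)^-1)
| mono_ext f g : (forall a, D a -> f a = g a) -> monomial G f -> monomial G g.

Lemma mono_trans (G G' : (A -> R) -> Prop) f :
  (forall g, G g -> monomial G' g) -> monomial G f -> monomial G' f.
Proof.
move=> GG'; elim=> {f}.
- exact: GG'.
- exact: mono_one.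
- by move=> f g _ Hf _ Hg; apply: mono_mul.
- by move=> f _ Hf; apply: mono_inv.
- by move=> f g e _ Hf; apply: mono_ext Hf.
Qed.

Lemma monomial_exponents (T : finType) (p : A -> T -> R) (E : {set T}) (G : (A -> R) -> Prop) f :
    (forall a I, D a -> I \in E -> p a I != 0) ->
    (forall g, G g -> (forall a, D a -> g a = 1) \/
       exists2 I, I \in E & forall a, D a -> g a = p a I) ->
  monomial G f -> exists e : T -> int, forall a, D a -> f a = \prod_(I in E) p a I ^ e I.
Proof.
move=> pn0 HG; elim=> {f}.
- move=> g /HG[g1|[I0 I0E gE]].
    by exists (fun=> 0) => a Da; rewrite g1 // big1 // => I _; rewrite expr0z.
  exists (fun I => (I == I0)%:Z) => a Da; rewrite gE // (bigD1 I0) //= eqxx expr1z.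
  by rewrite big1 ?mulr1 // => I /andP[_ /negbTE->]; rewrite expr0z.
- by exists (fun=> 0) => a Da; rewrite big1 // => I _; rewrite expr0z.
- move=> f g _ [e He] _ [e' He']; exists (fun I => e I + e' I) => a Da.
  rewrite He // He' // -big_split /=; apply: eq_bigr => I IE.
  by rewrite expfzDr // pn0.
- move=> f _ [e He]; exists (fun I => - e I) => a Da.
  by rewrite He // -prodfV; apply: eq_bigr => I IE; rewrite invr_expz.
- by move=> f g fg _ [e He]; exists e => a Da; rewrite -fg // He.
Qed.

End Monomials.

(** * Initial segments of a one-line notation *)

Section Initial.
Variable n : nat.
Implicit Types x f c : nat -> 'I_n.

(** For the one-line notation of v^-1 this will be the Gale-minimal basis with [k] columns. *)
Fixpoint initset x k : {set 'I_n} := if k is k'.+1 then x k' |: initset x k' else set0.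

Lemma in_initset x k j : reflect (exists2 i, (i < k)%N & j = x i) (j \in initset x k).
Proof.
elim: k => [|k IH] /=; first by rewrite inE; constructor=> -[].
rewrite !inE; apply: (iffP orP) => [[/eqP->|/IH[i ik ->]]|[i]].
- by exists k.
- by exists i => //; apply: ltnW.
rewrite ltnS leq_eqVlt => /orP[/eqP->->|ik e]; [by left|right].
by apply/IH; exists i.
Qed.

Lemma initset_sub x k l : (k <= l)%N -> initset x k \subset initset x l.
Proof.
move=> kl; apply/subsetP => j /in_initset[i ik ->]; apply/in_initset.
by exists i => //; apply: leq_trans kl.
Qed.

Lemma card_initset_leq x k : (#|initset x k| <= k)%N.
Proof.
elim: k => [|k IH] /=; first by rewrite cards0.
by rewrite cardsU1 -add1n leq_add // leq_b1.
Qed.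

Lemma notin_initset x k l : #|initset x l.+1| = l.+1 -> (k <= l)%N -> x l \notin initset x k.
Proof.
move=> cl kl; apply: contra_eqN cl => xk.
have xl : x l \in initset x l by apply: subsetP xk; apply: initset_sub.
by rewrite /= cardsU1 xl neq_ltn ltnS card_initset_leq.
Qed.

(* One pass through a block: [f] holds the values before the pass, the value
   [c k] is carried across position [k], and [x] holds the values after it. *)
Lemma initset_pass x f c (pr : nat -> bool) m :
    (forall k, (k < m)%N -> c k = if pr k then c k.+1 else f k) ->
    x 0%N = c 0%N ->
    (forall k, (k < m)%N -> x k.+1 = if pr k then f k else c k.+1) ->
  forall k, (k <= m)%N -> initset x k.+1 = c k |: initset f k.
Proof.
move=> cE x0 xE; elim=> [|k IH] km; first by rewrite /= x0.
by rewrite [LHS]/= -/(initset x k.+1) IH 1?ltnW //= xE // (cE k) //; case: (pr k); rewrite // setUCA.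
Qed.

End Initial.

(** * One block *)

Section Step.
Variables (n : nat) (R : realFieldType) (A : Type) (D : A -> Prop) (a0 : A).
Hypothesis Da0 : D a0.

Definition orb (P : A -> {set 'I_n} -> R) (x : nat -> 'I_n) k t :=
  iter t (Xi (P a0)) (initset x k).

Definition orbit_coord P x (f : A -> R) :=
  exists k t, (k <= n)%N /\ forall a, D a -> f a = P a (orb P x k t).

(* [x] and [y] are the one-line notations of v^-1 and w^-1, [row a l] is the row
   [l] of the matrix with parameters [a], and [P a] its Plücker coordinates. The
   orbits are computed at [a0]; [good_Xi] says that they do not depend on [a]. *)
Record good (P : A -> {set 'I_n} -> R) (row : A -> nat -> 'I_n -> R) (x y : nat -> 'I_n) :
  Prop := Good {
  good_card : forall k, (k <= n)%N -> #|initset x k| = k;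
  good_low : forall a l j, D a -> (l < n)%N -> row a l j != 0 -> (x l <= j)%N;
  good_sign : forall a l, D a -> (l < n)%N ->
    row a l (x l) = (-1) ^+ #|above (initset x l) (x l)|;
  good_up : forall a l j, D a -> (l < n)%N -> row a l j != 0 -> exists2 i, (i <= l)%N & (j <= y i)%N;
  good_rec : forall a l, D a -> (l < n)%N -> (forall i, (i < l)%N -> (y i < y l)%N) ->
    row a l (y l) != 0;
  good_Plow : forall a I t, D a -> P a I != 0 -> (#|upto I t| <= #|upto (initset x #|I|) t|)%N;
  good_Pup : forall a I j, D a -> P a I != 0 -> j \in I -> exists2 i, (i < #|I|)%N & (j <= y i)%N;
  good_min : forall a k, D a -> (k <= n)%N -> P a (initset x k) = 1;
  good_Xi : forall a k t, D a -> (k <= n)%N -> Xi (P a) (orb P x k t) = orb P x k t.+1 }.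

Lemma orb_card P x k t : #|orb P x k t| = #|initset x k|.
Proof. by elim: t => //= t IH; rewrite card_Xi. Qed.

Lemma orb_neq0 P row x y a k t :
  good P row x y -> D a -> (k <= n)%N -> P a (orb P x k t) != 0.
Proof.
move=> gP Da kn; elim: t => [|t IH]; first by rewrite /= (good_min gP) ?oner_eq0.
by rewrite -(good_Xi gP _ Da kn) Xi_neq0.
Qed.

Lemma orb_full P x t : #|initset x n| = n -> orb P x n t = initset x n.
Proof.
move=> cx; have full (I : {set 'I_n}) : #|I| = n -> I = setT.
  by move=> cI; apply/eqP; rewrite eqEcard subsetT cardsT card_ord cI leqnn.
by rewrite (full _ cx) (full (orb _ _ _ _)) // orb_card.
Qed.

Lemma orb0 P x t : orb P x 0 t = set0.
Proof. by apply/eqP; rewrite -cards_eq0 orb_card cards0. Qed.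

Lemma orb_eq P x k (F : nat -> {set 'I_n}) :
    F 0%N = initset x k -> (forall a t, D a -> Xi (P a) (F t) = F t.+1) ->
  forall t, orb P x k t = F t.
Proof. by move=> F0 FS; elim=> //= t IH; rewrite -/(orb P x k t) IH FS. Qed.

Variables (Q : A -> {set 'I_n} -> R) (rowN : A -> nat -> 'I_n -> R) (x' y' : nat -> 'I_n).
Hypothesis gQ : good Q rowN x' y'.
(** [pres k]: the letter [k] of the block belongs to the word of w. [dot k]: it is moreover selected
    for v. [val k a] is the parameter of a letter that is present but not selected. *)
Variables (pres dot : nat -> bool) (val : nat -> A -> R).
Hypothesis dot_pres : forall k, dot k -> pres k.
Hypothesis pres_lt : forall k, pres k -> (k.+1 < n)%N.
Hypothesis val_neq0 : forall a k, D a -> pres k -> ~~ dot k -> val k a != 0.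
Variables (b c : nat -> 'I_n) (r : A -> nat -> 'I_n -> R).
Hypothesis bE : forall k, (k < n)%N -> b k = if dot k then b k.+1 else x' k.
Hypothesis cE : forall k, (k < n)%N -> c k = if pres k then c k.+1 else y' k.
Hypothesis rE : forall a k j, (k < n)%N -> r a k j =
  if dot k then r a k.+1 j
  else if pres k then rowN a k j + val k a * r a k.+1 j else rowN a k j.
Variables (P : A -> {set 'I_n} -> R) (row : A -> nat -> 'I_n -> R) (x y : nat -> 'I_n).
Hypothesis x0 : x 0%N = b 0%N.
Hypothesis y0 : y 0%N = c 0%N.
Hypothesis row0 : forall a, row a 0%N =1 r a 0%N.
Hypothesis xS : forall k, (k.+1 < n)%N -> x k.+1 = if dot k then x' k else b k.+1.
Hypothesis yS : forall k, (k.+1 < n)%N -> y k.+1 = if pres k then y' k else c k.+1.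
Hypothesis rowS : forall a k j, (k.+1 < n)%N ->
  row a k.+1 j = if dot k then - rowN a k j else r a k.+1 j.
(** What the two positive distinguished subexpressions provide: a letter in the word of w is an
    ascent for v, selected or not, and every letter of the block is an ascent for w. [asc_y] also
    covers the positions after the block. *)
Hypothesis asc_x : forall k, pres k -> (x' k < b k.+1)%N.
Hypothesis asc_y : forall k, (k.+1 < n)%N -> (y' k < c k.+1)%N.
Hypothesis expand : forall a k (I : {set 'I_n}), #|I| = k.+1 ->
  P a I = \sum_(j in I) (-1) ^+ #|above I j| * r a k j * Q a (I :\ j).
Hypothesis P0 : forall a, P a set0 = 1.

(** Downward induction, since the carried values and the rows at [k] are determined by those at
    [k.+1]. *)
Lemma down_ind (S : nat -> Prop) :
  (forall k, (k < n)%N -> ((k.+1 < n)%N -> S k.+1) -> S k) -> forall k, (k < n)%N -> S k.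
Proof.
move=> H k kn; have [m] := ubnP (n - k)%N; elim: m k kn => // m IH k kn lem.
by apply: H => // k1n; apply: IH => //; lia.
Qed.

(** The carried value comes from a position at or after [k], which is why it is not among the first
    [k] values. *)
Lemma carry_x k : (k < n)%N -> exists2 l, (k <= l < n)%N & b k = x' l.
Proof.
move: k; apply: down_ind => k kn IH; rewrite bE //; case dk: (dot k); last by exists k; rewrite ?leqnn.
have [l /andP[kl ln] ->] := IH (pres_lt (dot_pres dk)).
by exists l => //; rewrite ln andbT ltnW.
Qed.

Lemma b_notin k : (k < n)%N -> b k \notin initset x' k.
Proof.
move=> kn; have [l /andP[kl ln] ->] := carry_x kn.
by apply: notin_initset => //; apply: (good_card gQ).
Qed.

Lemma c_mono k : (k.+1 < n)%N -> (c k <= c k.+1)%N.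
Proof. by move=> kn; rewrite cE ?(ltnW kn) //; case: ifP => // _; apply/ltnW/asc_y. Qed.

Lemma lt_c k i : (k < n)%N -> (i < k)%N -> (y' i < c k)%N.
Proof.
elim: k => // k IH kn; rewrite ltnS leq_eqVlt => /orP[/eqP->|ik]; first exact: asc_y.
by apply: leq_trans (IH (ltnW kn) ik) (c_mono kn).
Qed.

Lemma initset_x k : (k < n)%N -> initset x k.+1 = b k |: initset x' k.
Proof.
move=> kn; apply: (@initset_pass _ _ _ _ dot n.-1) => //; try lia.
  by move=> l ln; apply: bE; lia.
by move=> l ln; apply: xS; lia.
Qed.

Lemma initset_y k : (k < n)%N -> initset y k.+1 = c k |: initset y' k.
Proof.
move=> kn; apply: (@initset_pass _ _ _ _ pres n.-1) => //; try lia.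
  by move=> l ln; apply: cE; lia.
by move=> l ln; apply: yS; lia.
Qed.

Section Fixed.
Variable a : A.
Hypothesis Da : D a.

(** At a letter that is present but not selected, the row of N starts at [x' k = b k], and the added
    row starts at [b k.+1], further right by [asc_x]. *)
Lemma r_low k j : (k < n)%N -> r a k j != 0 -> (b k <= j)%N.
Proof.
move: k; apply: down_ind => k kn IH; rewrite rE // bE //.
case dk: (dot k); first exact: IH (pres_lt (dot_pres dk)).
case pk: (pres k); last exact: (good_low gQ).
have [z|nz _] := eqVneq (rowN a k j) 0; last exact: (good_low gQ) nz.
rewrite z add0r mulf_eq0 negb_or => /andP[_ /(IH (pres_lt pk)) bj].
exact: leq_trans (ltnW (asc_x pk)) bj.
Qed.

Lemma rowN_lt k l j : (k < n)%N -> (l < k)%N -> rowN a l j != 0 -> (j < c k)%N.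
Proof.
move=> kn lk /(good_up gQ Da (ltn_trans lk kn))[i il ji].
by apply: leq_ltn_trans ji (lt_c kn (leq_ltn_trans il lk)).
Qed.

Lemma r_top k j : (k < n)%N -> r a k j != 0 -> (j <= c k)%N.
Proof.
move: k; apply: down_ind => k kn IH; rewrite rE // cE //.
case dk: (dot k); first by rewrite dot_pres //; apply: IH (pres_lt (dot_pres dk)).
case pk: (pres k).
  have [z|nz _] := eqVneq (rowN a k j) 0; last exact/ltnW/(rowN_lt (pres_lt pk) (leqnn _) nz).
  by rewrite z add0r mulf_eq0 negb_or => /andP[_]; apply: IH (pres_lt pk).
move=> /(good_up gQ Da kn)[i]; rewrite leq_eqVlt => /orP[/eqP->//|ik ji].
have := lt_c kn ik; rewrite (cE kn) pk => h.
exact: leq_trans ji (ltnW h).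
Qed.

(** At a selected letter the set loses [x' k], which lies before the carried value and does not
    affect the count. At an unselected one the added row vanishes in column [x' k]. *)
Lemma r_b k : (k < n)%N -> r a k (b k) = (-1) ^+ #|above (initset x' k) (b k)|.
Proof.
move: k; apply: down_ind => k kn IH; rewrite rE // (bE kn).
case dk: (dot k).
  have pk := dot_pres dk; have k1n := pres_lt pk.
  rewrite (IH k1n); congr (_ ^+ _); apply: eq_card => i; rewrite !inE.
  have [->|//] := eqVneq i (x' k); rewrite ltnNge ltnW ?asc_x // andbF.
  by rewrite [_ \in _](negbTE _) //; apply: notin_initset => //; apply: (good_card gQ).
case pk: (pres k); last exact: (good_sign gQ).
rewrite (good_sign gQ) // [r a k.+1 _](_ : _ = 0) ?mulr0 ?addr0 //.
apply/eqP/negPn/negP => /(r_low (pres_lt pk)).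
by rewrite leqNgt asc_x.
Qed.

(** The row [k] of N ends before the carried column [c k], so a present letter contributes only
    through the next row. Hence a parameter is the quotient of two consecutive values
    [r a k (c k)]. *)
Lemma r_c k : (k < n)%N -> r a k (c k) =
  if dot k then r a k.+1 (c k.+1)
  else if pres k then val k a * r a k.+1 (c k.+1) else rowN a k (y' k).
Proof.
move=> kn; rewrite rE // (cE kn).
case dk: (dot k); first by rewrite dot_pres.
case pk: (pres k) => //.
rewrite [rowN a k _](_ : _ = 0) ?add0r //.
by apply/eqP/negPn/negP => /(rowN_lt (pres_lt pk) (leqnn _)); rewrite ltnn.
Qed.

(** When the letter is absent, [c k = y' k] exceeds all earlier values of [y'], so it is a
    left-to-right maximum and [good_rec] applies. *)
Lemma r_c_neq0 k : (k < n)%N -> r a k (c k) != 0.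
Proof.
move: k; apply: down_ind => k kn IH; rewrite r_c //.
case dk: (dot k); first exact: IH (pres_lt (dot_pres dk)).
case pk: (pres k); first by rewrite mulf_neq0 ?val_neq0 ?dk // IH // pres_lt.
apply: (good_rec gQ) => // i ik.
by have := lt_c kn ik; rewrite cE // pk.
Qed.

Variable k : nat.
Hypothesis kn : (k < n)%N.
Let cJ0 : #|initset x' k| = k := good_card gQ (ltnW kn).

Let Qtop (J : {set 'I_n}) : #|J| = k -> Q a J != 0 -> forall j, j \in J -> (j < c k)%N.
Proof.
move=> Jk QJ j jJ; have [i] := good_Pup gQ Da QJ jJ; rewrite Jk => ik ji.
exact: leq_ltn_trans ji (lt_c kn ik).
Qed.

Let Qlow (J : {set 'I_n}) :
  #|J| = k -> Q a J != 0 -> forall t, (#|upto J t| <= #|upto (initset x' k) t|)%N.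
Proof. by move=> Jk QJ t; have := good_Plow gQ t Da QJ; rewrite Jk. Qed.

Let rlow j : r a k j != 0 -> (b k <= j)%N := @r_low k j kn.
Let rtop j : r a k j != 0 -> (j <= c k)%N := @r_top k j kn.
Let rb := r_b kn.
Let rc := r_c_neq0 kn.
Let bJ0 := b_notin kn.
Let QJ0 : Q a (initset x' k) = 1 := good_min gQ Da (ltnW kn).
Let ex := @expand a k.

Lemma P_top (I : {set 'I_n}) :
  #|I| = k.+1 -> P a I != 0 -> forall i, i \in I -> (i <= c k)%N.
Proof. exact: level_top ex Qtop rtop I. Qed.

Lemma P_low (I : {set 'I_n}) : #|I| = k.+1 -> P a I != 0 ->
  forall t, (#|upto I t| <= #|upto (initset x k.+1) t|)%N.
Proof. by rewrite initset_x //; apply: level_low ex Qlow rlow bJ0 I. Qed.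

Lemma P_min : P a (initset x k.+1) = 1.
Proof. by rewrite initset_x //; apply: level_min ex Qlow rlow rb cJ0 bJ0 QJ0. Qed.

Lemma P_addc (J : {set 'I_n}) : #|J| = k -> c k \notin J ->
  P a (c k |: J) = r a k (c k) * Q a J.
Proof. exact: level_c ex Qtop J. Qed.

Lemma bk_le_ck : (b k <= c k)%N.
Proof. exact: b_le_c ex Qtop Qlow rlow rtop rb cJ0 bJ0 QJ0. Qed.

Let J t := orb Q x' k t.

Lemma orbJ_card t : #|J t| = k.
Proof. by rewrite orb_card. Qed.

Lemma orbJ_neq0 t : Q a (J t) != 0.
Proof. exact: orb_neq0 gQ Da (ltnW kn). Qed.

Lemma orbJ_c t : c k \notin J t.
Proof. exact: c_notin Qtop _ (orbJ_card t) (orbJ_neq0 t). Qed.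

Lemma Xi_P_addc t : Xi (P a) (c k |: J t) = c k |: J t.+1.
Proof.
by rewrite (Xi_addc ex Qtop rtop rc (orbJ_card t) (orbJ_neq0 t)) (good_Xi gQ _ Da (ltnW kn)).
Qed.

Lemma P_addb t : b k \notin J t -> below (J t) (b k) = below (J 0%N) (b k) ->
  P a (b k |: J t) = Q a (J t).
Proof. exact: level_b ex Qlow rlow rb cJ0 bJ0 _ (orbJ_card t). Qed.

Lemma Xi_P_follow t : b k \notin J t -> below (J t) (b k) = below (J 0%N) (b k) ->
    J t.+1 != J t -> below (J t.+1) (b k) = below (J t) (b k) ->
  b k \notin J t.+1 /\ Xi (P a) (b k |: J t) = b k |: J t.+1.
Proof.
rewrite -[J t.+1](good_Xi gQ _ Da (ltnW kn)) => *.
exact: (Xi_addb_follow ex Qlow rlow rb cJ0 bJ0 (orbJ_card t) (orbJ_neq0 t)).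
Qed.

Lemma Xi_P_jump t : (b k < c k)%N ->
    b k \notin J t -> below (J t) (b k) = below (J 0%N) (b k) ->
    J t.+1 = J t \/ below (J t.+1) (b k) != below (J t) (b k) ->
  Xi (P a) (b k |: J t) = c k |: J t.
Proof.
rewrite -[J t.+1](good_Xi gQ _ Da (ltnW kn)) => *.
exact: (Xi_addb_jump ex Qtop Qlow rlow rtop rb rc cJ0 bJ0 _ (orbJ_card t) (orbJ_neq0 t)).
Qed.

End Fixed.

Lemma step_card k : (k <= n)%N -> #|initset x k| = k.
Proof.
case: k => [|k] kn; first by rewrite /= cards0.
by rewrite initset_x // cardsU1 b_notin // (good_card gQ) // ltnW.
Qed.

Lemma le_c_initset_y k : (k < n)%N -> exists2 i, (i <= k)%N & c k = y i.
Proof.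
move=> kn; have /in_initset[i ik ->] : c k \in initset y k.+1.
  by rewrite (initset_y kn) setU11.
by exists i.
Qed.

Lemma step_low a l j : D a -> (l < n)%N -> row a l j != 0 -> (x l <= j)%N.
Proof.
move=> Da; case: l => [|k] kn; first by rewrite row0 x0; apply: r_low.
rewrite rowS // xS //; case: (dot k); last exact: r_low.
by rewrite oppr_eq0; apply: (good_low gQ) => //; apply: ltnW.
Qed.

Lemma step_sign a l : D a -> (l < n)%N ->
  row a l (x l) = (-1) ^+ #|above (initset x l) (x l)|.
Proof.
move=> Da; case: l => [|k] kn; first by rewrite row0 x0 r_b.
rewrite rowS // xS // initset_x ?(ltnW kn) //; case dk: (dot k); last first.
  by rewrite r_b // (bE (ltnW kn)) dk.
(* The minus sign of the selected letter matches the one new element [b k] above [x' k]. *)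
rewrite (good_sign gQ) ?(ltnW kn) // -[- _]mulN1r -exprS; congr (_ ^+ _).
have xb : (x' k < b k)%N by rewrite (bE (ltnW kn)) dk asc_x // dot_pres.
rewrite (_ : above (_ |: _) _ = b k |: above (initset x' k) (x' k)).
  by rewrite cardsU1 inE (negbTE (b_notin _)) // ltnW.
by apply/setP => i; rewrite !inE; have [->|] := eqVneq i (b k); rewrite ?xb.
Qed.

Lemma step_up a l j : D a -> (l < n)%N -> row a l j != 0 ->
  exists2 i, (i <= l)%N & (j <= y i)%N.
Proof.
move=> Da ln nz; suff jc : (j <= c l)%N.
  by have [i il cy] := le_c_initset_y ln; exists i; rewrite -?cy.
case: l ln nz => [|k] kn; first by rewrite row0; apply: r_top.
rewrite rowS //; case: (dot k); last exact: r_top.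
by rewrite oppr_eq0 => /(rowN_lt Da kn (leqnn _))/ltnW.
Qed.

Lemma step_rec a l : D a -> (l < n)%N -> (forall i, (i < l)%N -> (y i < y l)%N) ->
  row a l (y l) != 0.
Proof.
move=> Da; case: l => [|k] kn yl; first by rewrite row0 y0 r_c_neq0.
have [i ik ci] := le_c_initset_y (ltnW kn).
case pk: (pres k).
  (* If the letter is present, [y k.+1 = y' k] is smaller than [c k], which is one of the earlier
     values of [y]; so it is not a record. *)
  have := yl i ik; rewrite -ci yS // pk (cE (ltnW kn)) pk => h.
  by have := ltn_trans h (asc_y kn); rewrite ltnn.
rewrite rowS // (contraFF (@dot_pres k) pk) yS // pk.
exact: r_c_neq0.
Qed.

Lemma step_Plow a (I : {set 'I_n}) t : D a -> P a I != 0 ->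
  (#|upto I t| <= #|upto (initset x #|I|) t|)%N.
Proof.
move=> Da PI; case Ik: #|I| => [|k].
  by rewrite (cards0_eq Ik); apply: subset_leq_card; apply/subsetP => i; rewrite !inE.
have kn : (k < n)%N by rewrite -Ik card_set_le.
  exact: (P_low Da kn Ik PI t).
Qed.

Lemma step_Pup a (I : {set 'I_n}) j : D a -> P a I != 0 -> j \in I ->
  exists2 i, (i < #|I|)%N & (j <= y i)%N.
Proof.
move=> Da PI jI; case Ik: #|I| => [|k]; first by move: jI; rewrite (cards0_eq Ik) inE.
have kn : (k < n)%N by rewrite -Ik card_set_le.
have [i il cy] := le_c_initset_y kn; exists i => //.
by rewrite -cy; apply: (P_top Da kn Ik PI).
Qed.

Lemma step_min a k : D a -> (k <= n)%N -> P a (initset x k) = 1.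
Proof. by move=> Da; case: k => [|k] kn; [apply: P0|apply: P_min]. Qed.

Section Orbit.
Variable k : nat.
Hypothesis kn : (k < n)%N.
Let J t := orb Q x' k t.

Lemma orbit_eq : b k = c k -> forall t, orb P x k.+1 t = c k |: J t.
Proof.
move=> bc; apply: orb_eq; first by rewrite initset_x // bc.
by move=> a t Da; apply: Xi_P_addc.
Qed.

Definition jumps t := (J t.+1 == J t) || (below (J t.+1) (b k) != below (J t) (b k)).

Lemma jumps_exists : exists t, jumps t.
Proof.
have [t e] := Xi_orbit_stable (Q a0) (initset x' k).
by exists t; rewrite /jumps /J /orb e eqxx.
Qed.

Definition jump := ex_minn jumps_exists.

Lemma lt_jump t : (t < jump)%N ->
  J t.+1 != J t /\ below (J t.+1) (b k) = below (J t) (b k).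
Proof.
move=> tj; suff : ~~ jumps t by rewrite /jumps negb_or negbK => /andP[ne /eqP e].
by apply: contraL tj; rewrite -leqNgt /jump; case: ex_minnP => m _ mn /mn.
Qed.

(** [J jump] occurs twice, first with [b k] and then with [c k]; from there on the index lags by
    one. *)
Definition orbit_step t :=
  if (t <= jump)%N then b k |: J t else c k |: J t.-1.

Lemma before_jump t : (t <= jump)%N ->
  b k \notin J t /\ below (J t) (b k) = below (J 0%N) (b k).
Proof.
elim: t => [|t IH] tj; first by split=> //; apply: b_notin.
have [bJ eJ] := IH (ltnW tj).
have [ne e] := lt_jump tj.
by have [? _] := Xi_P_follow Da0 kn bJ eJ ne e; rewrite -eJ -e.
Qed.

Lemma Xi_orbit_step a t : D a -> (b k < c k)%N ->
  Xi (P a) (orbit_step t) = orbit_step t.+1.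
Proof.
move=> Da bc; rewrite /orbit_step; case: ltngtP => tj.
- have [bJ eJ] := before_jump (ltnW tj).
  have [ne e] := lt_jump tj.
  by have [_ ->] := Xi_P_follow Da kn bJ eJ ne e.
- by case: t tj => // t tj; rewrite Xi_P_addc.
have [bJ eJ] := before_jump (eq_leq tj).
apply: Xi_P_jump => //; move: tj; rewrite /jump; case: ex_minnP => m jm _ ->.
by case/orP: jm => [/eqP|]; [left|right].
Qed.

Lemma orbit_lt : (b k < c k)%N -> forall t, orb P x k.+1 t = orbit_step t.
Proof.
move=> bc; apply: orb_eq; first by rewrite initset_x.
by move=> a t Da; apply: Xi_orbit_step.
Qed.

Lemma b_cases : b k = c k \/ (b k < c k)%N.
Proof.
by have := bk_le_ck Da0 kn; rewrite leq_eqVlt => /orP[/eqP/val_inj|]; [left|right].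
Qed.

Lemma step_Xi_S a t : D a -> Xi (P a) (orb P x k.+1 t) = orb P x k.+1 t.+1.
Proof.
move=> Da; have [bc|bc] := b_cases; first by rewrite !orbit_eq // Xi_P_addc.
by rewrite !orbit_lt // Xi_orbit_step.
Qed.

Local Notation mono := (monomial D (orbit_coord P x)).

Lemma mono_orb t : mono (fun a => P a (orb P x k.+1 t)).
Proof. by apply: mono_gen; exists k.+1, t. Qed.

Lemma before_jump_coord a t : D a -> (b k < c k)%N -> (t <= jump)%N ->
  Q a (J t) = P a (orb P x k.+1 t).
Proof.
move=> Da bc tj; rewrite orbit_lt // /orbit_step tj.
by have [bJ eJ] := before_jump tj; rewrite P_addb.
Qed.

Lemma after_jump_coord a t : D a -> (b k < c k)%N -> (jump <= t)%N ->
  P a (orb P x k.+1 t.+1) = r a k (c k) * Q a (J t).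
Proof.
move=> Da bc tj; rewrite orbit_lt // /orbit_step ltnNge tj /= P_addc //.
  by rewrite orbJ_card.
exact: (orbJ_c Da kn t).
Qed.

(** The two coordinates on either side of the jump share the factor [Q a (J jump)], and their
    quotient is [r a k (c k)]. If [b k = c k], the value is 1, by comparing the coordinates of the
    two minimal bases. *)
Lemma mono_r_c : mono (fun a => r a k (c k)).
Proof.
have [bc|bc] := b_cases.
  apply: mono_ext (mono_one _ _) => a Da.
  have := P_addc Da kn (orbJ_card kn 0) (orbJ_c Da kn 0).
  by rewrite /orb /= -bc -initset_x // (step_min Da) // (good_min gQ) ?(ltnW kn) // mulr1.
apply: mono_ext (mono_mul (mono_orb jump.+1) (mono_inv (mono_orb jump))) => a Da /=.
rewrite after_jump_coord // before_jump_coord // mulfK //.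
by rewrite -before_jump_coord //; apply: (orb_neq0 _ gQ Da (ltnW kn)).
Qed.

Lemma mono_Q_lt t : mono (fun a => Q a (J t)).
Proof.
have [bc|bc] := b_cases.
  apply: mono_ext (mono_mul (mono_orb t) (mono_inv mono_r_c)) => a Da /=.
  rewrite (orbit_eq bc) (P_addc Da kn (orbJ_card kn t) (orbJ_c Da kn t)).
  by rewrite mulrC mulKf ?(r_c_neq0 Da kn).
have [tj|jt] := leqP t jump.
  by apply: mono_ext (mono_orb t) => a Da; rewrite before_jump_coord.
apply: mono_ext (mono_mul (mono_orb t.+1) (mono_inv mono_r_c)) => a Da /=.
by rewrite (after_jump_coord Da bc (ltnW jt)) mulrC mulKf ?(r_c_neq0 Da kn).
Qed.

End Orbit.

Lemma step_good : good P row x y.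
Proof.
split.
- exact: step_card.
- exact: step_low.
- exact: step_sign.
- exact: step_up.
- exact: step_rec.
- exact: step_Plow.
- exact: step_Pup.
- exact: step_min.
move=> a [|k] t Da kn; last exact: step_Xi_S.
by rewrite !orb0; apply: cards0_eq; rewrite card_Xi cards0.
Qed.

(** The orbit of N with [k] columns is read off from that of M with [k.+1] columns; for [k = n]
    there is no such orbit, but the coordinate is 1. *)
Lemma step_mono f : monomial D (orbit_coord Q x') f -> monomial D (orbit_coord P x) f.
Proof.
apply: mono_trans => g [k [t [kn gE]]]; move: kn gE; rewrite leq_eqVlt.
case/orP=> [/eqP->|kn] gE; last by apply: mono_ext (mono_Q_lt kn t) => a Da; rewrite gE.
apply: mono_ext (mono_one _ _) => a Da.
by rewrite gE // orb_full ?(good_min gQ) ?(good_card gQ).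
Qed.

Lemma step_val k : pres k -> ~~ dot k -> monomial D (orbit_coord P x) (val k).
Proof.
move=> pk dk; have k1n := pres_lt pk.
apply: mono_ext (mono_mul (mono_r_c (ltnW k1n)) (mono_inv (mono_r_c k1n))) => a Da /=.
by rewrite (r_c Da (ltnW k1n)) (negbTE dk) pk mulfK // r_c_neq0.
Qed.

End Step.

(** * Plücker coordinates and row operations *)

Section Plucker.
Variables (n : nat) (R : realFieldType).
Implicit Types (M N : 'M[R]_n.+1) (I : {set 'I_n.+1}).

(** Entries indexed by natural numbers avoid casts when the size [#|I|] is rewritten. *)
Definition natdet k (f : nat -> nat -> R) := \det (\matrix_(i < k, j < k) f i j).

Lemma eq_natdet k f g :
  (forall i j, (i < k)%N -> (j < k)%N -> f i j = g i j) -> natdet k f = natdet k g.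
Proof.
by move=> e; congr (\det _); apply/matrixP => i j; rewrite !mxE e.
Qed.

Lemma natdet_expand k f : natdet k.+1 f =
  \sum_(l < k.+1) (-1) ^+ (k - l) * f k l * natdet k (fun i j => f i (bump l j)).
Proof.
rewrite /natdet (expand_det_row _ ord_max); apply: eq_bigr => l _.
rewrite mxE mulrAC mulrC; congr (_ * _); rewrite /cofactor; congr (_ * _).
  (* The exponents [k + l] and [k - l] have the same parity. *)
  rewrite -signr_odd -[in RHS]signr_odd; congr (_ ^+ nat_of_bool _).
  by rewrite oddD oddB //= -ltnS.
congr (\det _); apply/matrixP => i j; rewrite !mxE /=.
by rewrite /bump leqNgt ltn_ord.
Qed.

Lemma pluckE M I : pluck M I =
  natdet #|I| (fun i j => M (inord i) (nth ord0 (enum I) j)).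
Proof.
rewrite /pluck /natdet; congr (\det _); apply/matrixP => i j; rewrite !mxE.
rewrite (enum_val_nth ord0); congr (M _ _); apply/val_inj => /=.
by rewrite inordK // (leq_trans (ltn_ord i)) // card_set_le.
Qed.

Lemma eq_pluck M N I :
  (forall i j, (i < #|I|)%N -> M (inord i) j = N (inord i) j) -> pluck M I = pluck N I.
Proof. by move=> e; rewrite !pluckE; apply: eq_natdet => i j iI _; rewrite e. Qed.

Lemma pluck0 M : pluck M set0 = 1.
Proof. by rewrite pluckE cards0 /natdet det_mx00. Qed.

Lemma enum_setD1 I j : enum (I :\ j) = rem j (enum I).
Proof.
rewrite rem_filter ?enum_uniq // /enum_mem -filter_predI; apply: eq_filter => i.
by rewrite /= !inE.
Qed.

Lemma sorted_enum_set I : sorted ltn (map val (enum I)).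
Proof.
rewrite /enum_mem; apply: (subseq_sorted ltn_trans (map_subseq _ (filter_subseq _ _))).
by rewrite -enumT val_enum_ord iota_ltn_sorted.
Qed.

Lemma nth_enum_ltn I i j : (i < j < #|I|)%N ->
  (nth ord0 (enum I) i < nth ord0 (enum I) j)%N.
Proof.
move=> /andP[ij jI]; have iI := ltn_trans ij jI.
rewrite -!(nth_map ord0 0%N val) -?cardE //.
by apply: (sorted_ltn_nth ltn_trans 0%N (sorted_enum_set I)); rewrite ?inE ?size_map -?cardE.
Qed.

Lemma card_above_nth I l : (l < #|I|)%N ->
  #|above I (nth ord0 (enum I) l)| = (#|I| - l.+1)%N.
Proof.
move=> lI; set t := nth _ _ _.
have -> : #|above I t| = count (fun i : 'I_n.+1 => t < i)%N (enum I).
  rewrite cardE -size_filter; congr size; rewrite /enum_mem -filter_predI.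
  by apply: eq_filter => i; rewrite /= !inE andbC.
rewrite -[enum I](cat_take_drop l.+1) count_cat.
have /eqP-> : count (fun i : 'I_n.+1 => t < i)%N (take l.+1 (enum I)) == 0%N.
  rewrite -leqn0 leqNgt -has_count; apply/hasPn => i /(nthP ord0)[m].
  rewrite size_takel -?cardE // => ml <-; rewrite nth_take // -leqNgt.
  move: ml; rewrite ltnS leq_eqVlt => /orP[/eqP->//|ml].
  by apply/ltnW/nth_enum_ltn; rewrite ml.
rewrite add0n cardE -size_drop; apply/eqP; rewrite -all_count.
apply/(all_nthP ord0) => m; rewrite size_drop nth_drop -cardE => mI.
apply: nth_enum_ltn; rewrite addSn ltnS leq_addr /= -addSn -ltn_subRL; exact: mI.
Qed.

Lemma pluck_expand M I k : #|I| = k.+1 ->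
  pluck M I = \sum_(j in I) (-1) ^+ #|above I j| * M (inord k) j * pluck M (I :\ j).
Proof.
move=> Ik; rewrite pluckE Ik natdet_expand -[in RHS]big_enum /=.
rewrite [RHS](big_nth ord0) -cardE Ik big_mkord; apply: eq_bigr => l _.
have lI : (l < #|I|)%N by rewrite Ik.
rewrite card_above_nth // Ik subSS; congr (_ * _); rewrite pluckE.
have jI : nth ord0 (enum I) l \in I by rewrite -mem_enum mem_nth // -cardE.
have -> : #|I :\ nth ord0 (enum I) l| = k.
  by move: Ik; rewrite (cardsD1 (nth ord0 (enum I) l)) jI add1n => -[].
apply: eq_natdet => i j _ jk; congr (M _ _).
rewrite enum_setD1 remE index_uniq ?enum_uniq -?cardE // nth_cat size_take -?cardE // lI.
rewrite /bump; case: (ltnP j l) => jl; first by rewrite nth_take.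
by rewrite nth_drop; congr nth; lia.
Qed.

Definition add_row (i j : 'I_n.+1) (e : R) M : 'M[R]_n.+1 :=
  \matrix_(h, l) (M h l + (h == i)%:R * e * M j l).

Lemma det_add_row k (i j : 'I_k) (e : R) (M : 'M[R]_k) : i != j ->
  \det (\matrix_(h, l) (M h l + (h == i)%:R * e * M j l)) = \det M.
Proof.
move=> ij.
have -> : \matrix_(h, l) (M h l + (h == i)%:R * e * M j l) = (1%:M + e *: delta_mx i j) *m M.
  apply/matrixP => h l; rewrite mulmxDl mul1mx -scalemxAl !mxE; congr (_ + _).
  rewrite (bigD1 j) //= mxE eqxx andbT big1 ?addr0 => [|m mj]; first by rewrite mulrCA mulrA.
  by rewrite !mxE (negbTE mj) andbF mul0r.
rewrite det_mulmx; suff -> : \det (1%:M + e *: delta_mx i j : 'M[R]_k) = 1 by rewrite mul1r.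
have diag (h : 'I_k) : (1%:M + e *: delta_mx i j : 'M[R]_k) h h = 1.
  rewrite !mxE eqxx; have [->|] //= := eqVneq h i; last by rewrite mulr0 addr0.
  by rewrite (negbTE ij) mulr0 addr0.
(* The factor is unitriangular; it is transposed when it is upper triangular. *)
have [ltij|ltji|/val_inj/eqP] := ltngtP i j; last by rewrite (negbTE ij).
  rewrite -det_tr det_trig; last first.
    apply/is_trig_mxP => h l hl; rewrite !mxE (_ : l == h = false) ?add0r; last first.
      by apply/eqP => e1; rewrite e1 ltnn in hl.
    have [e1|] //= := eqVneq l i; last by rewrite mulr0.
    have [e2|] //= := eqVneq h j; last by rewrite mulr0.
    by move: hl; rewrite e1 e2 ltnNge ltnW.
  by rewrite big1 // => h _; rewrite mxE diag.
rewrite det_trig; first by rewrite big1 // => h _; rewrite diag.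
apply/is_trig_mxP => h l hl; rewrite !mxE (_ : h == l = false) ?add0r; last first.
  by apply/eqP => e1; rewrite e1 ltnn in hl.
have [e1|] //= := eqVneq h i; last by rewrite mulr0.
have [e2|] //= := eqVneq l j; last by rewrite mulr0.
by move: hl; rewrite e1 e2 ltnNge ltnW.
Qed.

Lemma pluck_add_row (i j : 'I_n.+1) e M I :
  i != j -> (i < #|I|)%N -> (j < #|I|)%N -> pluck (add_row i j e M) I = pluck M I.
Proof.
move=> ij iI jI; rewrite !pluckE /natdet.
have ij' : Ordinal iI != Ordinal jI by rewrite -(inj_eq val_inj).
rewrite -[RHS](det_add_row e _ ij'); congr (\det _); apply/matrixP => h l.
have hn : (h < n.+1)%N by apply: leq_trans (ltn_ord h) (card_set_le I).
rewrite !mxE /=; congr (_ + _ * _ * M _ _); last by rewrite inord_val.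
by rewrite -!(inj_eq val_inj) /= inordK.
Qed.

End Plucker.

(** * The letters as row operations *)

Section Letters.
Variables (n : nat) (R : realFieldType).
Implicit Types (M N : 'M[R]_n.+1) (I : {set 'I_n.+1}) (g : 'S_n.+1).

Lemma sdot_row k M (i j : 'I_n.+1) : (k < n)%N ->
  (sdot n.+1 R k.+1 *m M) i j =
  if i == k :> nat then M (inord k.+1) j
  else if i == k.+1 :> nat then - M (inord k) j else M i j.
Proof.
move=> kn; rewrite mxE.
have ik : (inord k : 'I_n.+1) = k :> nat by rewrite inordK // ltnS ltnW.
have ik1 : (inord k.+1 : 'I_n.+1) = k.+1 :> nat by rewrite inordK.
have nk : (k == k.+1) = false by lia.
have kn' : (k.+1 == k) = false by lia.
(* Each row of the signed permutation matrix has a single nonzero entry; this is its column. *)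
rewrite (bigD1 (if i == k :> nat then inord k.+1
                else if i == k.+1 :> nat then inord k else i)) //= big1 ?addr0 => [|l].
  rewrite mxE; have [ei|ni] := eqVneq (i : nat) k.
    by rewrite ei ik1 !eqxx kn' mul1r.
  have [ei|ni1] := eqVneq (i : nat) k.+1; first by rewrite ei ik !eqxx nk kn' mulN1r.
  by rewrite eqxx mul1r.
rewrite mxE -!(inj_eq val_inj) /=.
have [ei|ni] := eqVneq (i : nat) k.
  rewrite ik1 => /negbTE ->; rewrite ei nk /= [k == l :> nat]eq_sym.
  by case: eqP; rewrite ?mul0r.
have [ei|ni1] := eqVneq (i : nat) k.+1.
  rewrite ik => /negbTE -> /=; rewrite ei [k.+1 == l :> nat]eq_sym.
  by case: eqP; rewrite ?mul0r.
by rewrite eq_sym => /negbTE ->; rewrite mul0r.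
Qed.

Lemma xmat_row k (e : R) M (i j : 'I_n.+1) : (k < n)%N ->
  (xmat n.+1 k.+1 e *m M) i j =
  if i == k :> nat then M i j + e * M (inord k.+1) j else M i j.
Proof.
move=> kn; rewrite mxE.
have ik1 : (inord k.+1 : 'I_n.+1) = k.+1 :> nat by rewrite inordK.
transitivity (\sum_l ((i == l)%:R * M l j +
   (if (i == k :> nat) && (l == inord k.+1) then e * M l j else 0))).
  apply: eq_bigr => l _; rewrite mxE mulrDl -!(inj_eq val_inj) /= ik1; congr (_ + _).
  by case: ifP => _; rewrite ?mul0r.
rewrite big_split /= (bigD1 i) //= eqxx mul1r big1 ?addr0 => [|l li]; last first.
  by rewrite eq_sym (negbTE li) mul0r.
case: eqP => ei /=; last by rewrite big1 ?addr0.
rewrite (bigD1 (inord k.+1)) //= eqxx big1 ?addr0 // => l /negbTE ->.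
by [].
Qed.

Lemma xmat_add_row k (e : R) M : (k < n)%N ->
  xmat n.+1 k.+1 e *m M = add_row (inord k) (inord k.+1) e M.
Proof.
move=> kn; apply/matrixP => i j; rewrite xmat_row // mxE -(inj_eq val_inj) /= inordK; last by lia.
by case: eqP; rewrite ?mul1r // !mul0r addr0.
Qed.

(** The rotation block is a product of three transvections: the rows (p, q) become (p+q, q), (p+q,
    -p), (q, -p). So minors using both rows are unchanged. *)
Lemma sdot_add_row k M : (k < n)%N -> sdot n.+1 R k.+1 *m M =
  add_row (inord k) (inord k.+1) 1
    (add_row (inord k.+1) (inord k) (-1) (add_row (inord k) (inord k.+1) 1 M)).
Proof.
move=> kn; apply/matrixP => i j; rewrite sdot_row // !mxE -!(inj_eq val_inj) /=.
rewrite !inordK //; try lia.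
rewrite !eqxx (_ : k.+1 == k = false); last by lia.
have [ei|ni] := eqVneq (i : nat) k.
  rewrite (_ : (i : nat) == k.+1 = false); last by lia.
  by rewrite (_ : i = inord k) /=; [ring|apply/val_inj; rewrite /= inordK //; lia].
have [ei|ni1] := eqVneq (i : nat) k.+1; last by rewrite /=; ring.
rewrite (_ : i = inord k.+1); last by apply/val_inj; rewrite /= inordK.
by rewrite /=; ring.
Qed.

Lemma pluck_xmat k (e : R) M I : (k.+1 < #|I|)%N ->
  pluck (xmat n.+1 k.+1 e *m M) I = pluck M I.
Proof.
move=> kI; have kn : (k < n)%N by have := leq_trans kI (card_set_le I).
by rewrite xmat_add_row // pluck_add_row -?(inj_eq val_inj) /= ?inordK ?(ltnW kI) //; lia.
Qed.

Lemma pluck_sdot k M I : (k.+1 < #|I|)%N -> pluck (sdot n.+1 R k.+1 *m M) I = pluck M I.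
Proof.
move=> kI; have kn : (k < n)%N by have := leq_trans kI (card_set_le I).
by rewrite sdot_add_row // !pluck_add_row -?(inj_eq val_inj) /= ?inordK ?(ltnW kI) //; lia.
Qed.

End Letters.

(** * The product of a block with a matrix *)

Section BlockMatrix.
Variables (n : nat) (R : realFieldType) (pres dot : nat -> bool) (K : nat).
Variables (val : nat -> R) (N : 'M[R]_n.+1).
Hypothesis pres_lt : forall k, pres k -> (k < K)%N.
Hypothesis Kn : (K <= n)%N.

(** Absent letters become identity factors, so that a block is indexed by positions and not by its
    chosen letters. *)
Definition letter_mx k : 'M[R]_n.+1 :=
  if pres k then if dot k then sdot n.+1 R k.+1 else xmat n.+1 k.+1 (val k) else 1%:M.

Definition block_mx_from k : 'M[R]_n.+1 :=
  foldr (fun i acc => letter_mx i *m acc) N (iota k (K - k)).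

Lemma block_mx_fromS k : block_mx_from k = letter_mx k *m block_mx_from k.+1.
Proof.
rewrite /block_mx_from; case: (ltnP k K) => kK.
  by rewrite (_ : K - k = (K - k.+1).+1)%N //; lia.
have pk : pres k = false by apply/negP => /pres_lt; rewrite ltnNge kK.
have -> : (K - k = 0)%N by lia.
have -> : (K - k.+1 = 0)%N by lia.
by rewrite /= /letter_mx pk mul1mx.
Qed.

Lemma letter_row k M (i j : 'I_n.+1) : i != k :> nat -> i != k.+1 :> nat ->
  (letter_mx k *m M) i j = M i j.
Proof.
move=> ik ik1; rewrite /letter_mx; case pk: (pres k); last by rewrite mul1mx.
have kn := leq_trans (pres_lt pk) Kn.
by case: (dot k); rewrite ?sdot_row ?xmat_row // (negbTE ik) ?(negbTE ik1).
Qed.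

Lemma block_row_lt k (i j : 'I_n.+1) : (i < k)%N -> block_mx_from k i j = N i j.
Proof.
have [m] := ubnP (K - k)%N; elim: m k => // m IH k lem ik.
case: (ltnP k K) => kK; last by rewrite /block_mx_from (_ : K - k = 0)%N //; lia.
by rewrite block_mx_fromS letter_row ?IH //; lia.
Qed.

(** The letters before [k] mix only rows up to [k], so the row [k.+1] is final once the letter [k]
    has acted. *)
Lemma block_row_gt m k j : (m <= k)%N -> (k < n)%N ->
  block_mx_from m (inord k.+1) j = block_mx_from k (inord k.+1) j.
Proof.
move=> mk kn; elim: k m mk kn => [|k IH] m; first by rewrite leqn0 => /eqP->.
rewrite leq_eqVlt => /orP[/eqP->//|mk] kn.
have [d] := ubnP (k.+1 - m)%N; elim: d m mk => // d IHd m mk lem.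
have [->//|ne] := eqVneq m k.+1.
rewrite block_mx_fromS letter_row ?inordK //; try lia.
by have [->//|ne1] := eqVneq m k; apply: IHd; lia.
Qed.

Definition block_row k (j : 'I_n.+1) := block_mx_from k (inord k) j.

Lemma block_rowE k j : (k < n.+1)%N -> block_row k j =
  if dot k && pres k then block_row k.+1 j
  else if pres k then N (inord k) j + val k * block_row k.+1 j else N (inord k) j.
Proof.
move=> kn; rewrite /block_row block_mx_fromS.
have e : block_mx_from k.+1 (inord k) j = N (inord k) j.
  by apply: block_row_lt; rewrite inordK.
rewrite /letter_mx; case pk: (pres k); last by rewrite andbF mul1mx.
have k1n := leq_trans (pres_lt pk) Kn.
by case: (dot k); rewrite ?sdot_row ?xmat_row // inordK // eqxx ?e.
Qed.

Lemma block_rowS k j : (k < n)%N -> block_mx_from 0 (inord k.+1) j =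
  if dot k && pres k then - N (inord k) j else block_row k.+1 j.
Proof.
move=> kn; rewrite (@block_row_gt 0 k) // block_mx_fromS.
have e : block_mx_from k.+1 (inord k) j = N (inord k) j.
  by apply: block_row_lt; rewrite inordK // ltnW.
rewrite /letter_mx; case pk: (pres k); last by rewrite andbF mul1mx.
have ne : (k.+1 == k) = false by lia.
by case: (dot k); rewrite ?sdot_row ?xmat_row // inordK // ?eqxx ne ?e.
Qed.

Lemma pluck_letter k M (I : {set 'I_n.+1}) :
  (k.+1 < #|I|)%N -> pluck (letter_mx k *m M) I = pluck M I.
Proof.
move=> kI; rewrite /letter_mx; case: (pres k); last by rewrite mul1mx.
by case: (dot k); rewrite ?pluck_sdot ?pluck_xmat.
Qed.

Lemma block_expand k (I : {set 'I_n.+1}) : #|I| = k.+1 ->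
  pluck (block_mx_from 0) I =
  \sum_(j in I) (-1) ^+ #|above I j| * block_row k j * pluck N (I :\ j).
Proof.
move=> Ik; have kn : (k < n.+1)%N by rewrite -Ik card_set_le.
have -> : pluck (block_mx_from 0) I = pluck (block_mx_from k) I.
  suff H m : (m <= k)%N -> pluck (block_mx_from 0) I = pluck (block_mx_from m) I by apply: H.
  elim: m => // m IH mk; rewrite IH ?(ltnW mk) // block_mx_fromS pluck_letter //.
  by rewrite Ik.
rewrite (pluck_expand _ Ik); apply: eq_bigr => j jI; congr (_ * _).
have cI : #|I :\ j| = k by move: Ik; rewrite (cardsD1 j) jI add1n => -[].
apply: eq_pluck => i l; rewrite cI => ik; rewrite block_row_lt //.
by rewrite inordK // (ltn_trans ik).
Qed.

End BlockMatrix.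

(** * Words and lengths *)

Section Words.
Variable n : nat.
Implicit Types (g h : 'S_n.+1).

Lemma sref_tperm k : (k < n)%N -> sref n.+1 k.+1 = tperm (inord k) (inord k.+1).
Proof.
move=> kn; rewrite /sref /=.
case: insubP => [i _ ei|]; last by rewrite ltnS (ltnW kn).
case: insubP => [j _ ej|]; last by rewrite ltnS kn.
by congr tperm; apply/val_inj; rewrite /= inordK // ltnS ltnW.
Qed.

Lemma sref_out k : (n < k)%N -> sref n.+1 k = 1%g.
Proof.
move=> nk; rewrite /sref; case: insubP => // i _ _.
by case: insubP => // j; rewrite ltnS leqNgt nk.
Qed.

Lemma sref0 : sref n.+1 0 = 1%g.
Proof. by rewrite /sref; case: insubP. Qed.

Lemma comp_srefK k g : pcomp (sref n.+1 k) (pcomp (sref n.+1 k) g) = g.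
Proof.
case: k => [|k].
  by rewrite sref0 /Defs.comp !mulg1.
have [kn|nk] := ltnP k n; last by rewrite sref_out // /Defs.comp !mulg1.
by rewrite sref_tperm // /Defs.comp -mulgA tperm2 mulg1.
Qed.

(** The one-line notation of g^-1: multiplying g on the left by a simple transposition swaps two
    adjacent entries of it. *)
Definition pos g k : 'I_n.+1 := (g^-1)%g (inord k).

Lemma pcompA g1 g2 h : pcomp (pcomp g1 g2) h = pcomp g1 (pcomp g2 h).
Proof. by rewrite /Defs.comp mulgA. Qed.

Lemma comp1g g : pcomp 1%g g = g. Proof. by rewrite /Defs.comp mulg1. Qed.

Lemma pos_sref k g i : (k < n)%N -> (i <= n)%N -> pos (pcomp (sref n.+1 k.+1) g) i =
  pos g (if i == k then k.+1 else if i == k.+1 then k else i).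
Proof.
move=> kn lin; rewrite /pos /Defs.comp invMg permM sref_tperm // tpermV; congr (_ _).
have eq a b : (a <= n)%N -> (b <= n)%N -> (inord a == inord b :> 'I_n.+1) = (a == b).
  by move=> an bn; rewrite -(inj_eq val_inj) /= !inordK.
case: tpermP => [/eqP|/eqP|/eqP ne /eqP ne1].
- by rewrite eq ?(ltnW kn) // => /eqP->; rewrite eqxx.
- by rewrite eq // => /eqP->; rewrite eqxx (_ : k.+1 == k = false) //; lia.
by move: ne ne1; rewrite !eq ?(ltnW kn) // => /negbTE-> /negbTE->.
Qed.

(** Exchanging the adjacent values [k] and [k.+1] creates the inversion at their two positions and
    changes no other pair. *)
Lemma len_sref_asc k g : (k < n)%N -> (pos g k < pos g k.+1)%N ->
  len (pcomp (sref n.+1 k.+1) g) = (len g).+1.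
Proof.
move=> kn asc; rewrite /len.
set S := [set p | _ & (g _ < _)%N]; set S' := [set p | _].
have ik : (inord k : 'I_n.+1) = k :> nat by rewrite inordK // ltnS ltnW.
have ik1 : (inord k.+1 : 'I_n.+1) = k.+1 :> nat by rewrite inordK.
have gp i : (i == pos g k) = (g i == inord k) by rewrite /pos -[in RHS](inj_eq (@perm_inj _ g^-1)) permK.
have gq i : (i == pos g k.+1) = (g i == inord k.+1) by rewrite /pos -[in RHS](inj_eq (@perm_inj _ g^-1)) permK.
suff -> : S' = (pos g k, pos g k.+1) |: S.
  by rewrite cardsU1 inE /= /pos !permKV ik ik1 [(k.+1 < k)%N]ltnNge leqnSn andbF.
apply/setP => -[i j]; rewrite !inE /= xpair_eqE gp gq /Defs.comp !permM sref_tperm //.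
have [ij|ji] /= := ltnP i j; last first.
  rewrite orbF; apply/esym/negbTE/negP; rewrite -gp -gq => /andP[/eqP ei /eqP ej].
  by move: asc; rewrite -ei -ej ltnNge ji.
have nij : g i != g j by rewrite (inj_eq perm_inj) -(inj_eq val_inj) /= neq_ltn ij.
have nqp : ~ (g i = k.+1 :> nat /\ g j = k :> nat).
  move=> [ei ej]; have /eqP : g i = inord k.+1 by apply/val_inj; rewrite /= ei ik1.
  have /eqP : g j = inord k by apply/val_inj; rewrite /= ej ik.
  by rewrite -gq -gp => /eqP ej' /eqP ei'; move: asc; rewrite -ei' -ej' ltnNge ltnW.
have tv (z : 'I_n.+1) : tperm (inord k) (inord k.+1) z =
    (if z == k :> nat then k.+1 else if z == k.+1 :> nat then k else z) :> nat.
  case: tpermP => [->|->|/eqP z1 /eqP z2]; rewrite ?ik ?ik1 ?eqxx //.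
    by rewrite (_ : k.+1 == k = false) //; lia.
  move: z1 z2; rewrite -!(inj_eq val_inj) /= ik ik1.
  by move=> /negbTE-> /negbTE->.
rewrite !tv -!(inj_eq val_inj) /= ik ik1.
move: nij nqp; rewrite -(inj_eq val_inj) /=; move: (g i : nat) (g j : nat) => s t st nqp.
by case: (s =P k) (s =P k.+1) (t =P k) (t =P k.+1) => [?|?] [?|?] [?|?] [?|?] /=; lia.
Qed.

Lemma pos_sref_swap k g : (k < n)%N -> pos (pcomp (sref n.+1 k.+1) g) k = pos g k.+1 /\
  pos (pcomp (sref n.+1 k.+1) g) k.+1 = pos g k.
Proof.
move=> kn; rewrite !pos_sref // ?(ltnW kn) // !eqxx.
by rewrite (_ : k.+1 == k = false) //; lia.
Qed.

Lemma len_sref_desc k g : (k < n)%N -> (pos g k.+1 < pos g k)%N ->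
  len g = (len (pcomp (sref n.+1 k.+1) g)).+1.
Proof.
move=> kn desc; have [e1 e2] := pos_sref_swap g kn.
by rewrite -[in LHS](comp_srefK k.+1 g) len_sref_asc // e1 e2.
Qed.

Lemma pos_neq k g : (k < n)%N -> pos g k != pos g k.+1.
Proof.
move=> kn; rewrite (inj_eq perm_inj) -(inj_eq val_inj) /= !inordK //; lia.
Qed.

Lemma len_sref_leq k g : (len (pcomp (sref n.+1 k) g) <= (len g).+1)%N.
Proof.
case: k => [|k]; first by rewrite sref0 comp1g.
have [kn|nk] := ltnP k n; last by rewrite sref_out // comp1g.
have [asc|desc|/val_inj/eqP] := ltngtP (pos g k) (pos g k.+1).
- by rewrite len_sref_asc.
- by rewrite (len_sref_desc kn desc) ltnW.
- by rewrite (negbTE (pos_neq _ kn)).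
Qed.

Lemma len_lt_pos k g : (k < n)%N -> (len g < len (pcomp (sref n.+1 k.+1) g))%N ->
  (pos g k < pos g k.+1)%N.
Proof.
move=> kn; have [//|desc|/val_inj/eqP] := ltngtP (pos g k) (pos g k.+1).
  by rewrite {1}(len_sref_desc kn desc) ltnNge leqnSn.
by rewrite (negbTE (pos_neq _ kn)).
Qed.

Lemma len1 : len (1%g : 'S_n.+1) = 0%N.
Proof.
apply/eqP; rewrite cards_eq0 -subset0; apply/subsetP => -[i j]; rewrite !inE /= !perm1.
by move=> /andP[ij ji]; have := ltn_trans ij ji; rewrite ltnn.
Qed.

Lemma len_wprod_leq u : (len (wprod n.+1 u) <= size u)%N.
Proof.
elim: u => [|i u IH] /=; first by rewrite len1.
by apply: leq_trans (len_sref_leq _ _) _; rewrite ltnS.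
Qed.

(* Both kinds of positions obey the same rule: a selected letter goes up because
   the subexpression is reduced, a skipped one because it is distinguished. *)
Fixpoint ascending g (u : seq nat) (m : bitseq) : bool :=
  match u, m with
  | i :: u', _ :: m' => let h := pcomp (wprod n.+1 (mask m' u')) g in
      (len h < len (pcomp (sref n.+1 i) h))%N && ascending g u' m'
  | _, _ => true
  end.

Lemma pds_ascending u (w : 'S_n.+1) m : is_pds u w m -> ascending 1%g u m.
Proof.
move=> /and4P[/eqP sz /eqP <-]; move=> /eqP; elim: u m sz => [|i u IH] [|b m] //= [sz].
rewrite /Defs.comp mul1g => red /andP[].
rewrite /later_prod /= !drop0 => h0; rewrite (iotaDl 1 0) all_map => hS.
(* A tail of a reduced word is reduced, as one letter adds at most 1 to the length. *)
have red' : size (mask m u) = len (wprod n.+1 (mask m u)).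
  apply/eqP; rewrite eqn_leq len_wprod_leq andbT.
  case: b red {h0 hS} => /= [red|-> //].
  by rewrite -ltnS red len_sref_leq.
rewrite IH // andbT; case: b red h0 {hS} => //= red _.
by rewrite -red -red'.
Qed.

Lemma wprod_cat u1 u2 : wprod n.+1 (u1 ++ u2) = pcomp (wprod n.+1 u1) (wprod n.+1 u2).
Proof. by elim: u1 => [|i u1 IH] /=; rewrite ?comp1g // IH pcompA. Qed.

Lemma ascending_cat g u1 u2 m1 m2 : size m1 = size u1 ->
  ascending g (u1 ++ u2) (m1 ++ m2) =
  ascending (pcomp (wprod n.+1 (mask m2 u2)) g) u1 m1 && ascending g u2 m2.
Proof.
elim: u1 m1 => [|i u1 IH] [|b m1] //= [sz].
by rewrite mask_cat // wprod_cat !pcompA IH // andbA.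
Qed.

End Words.

(** * A block acting on a one-line notation *)

Section Passes.
Variable n : nat.
Implicit Types (g h : 'S_n.+1) (pr : nat -> bool).

Definition pass g pr (s : seq nat) : 'S_n.+1 :=
  foldr (fun i h => if pr i then pcomp (sref n.+1 i.+1) h else h) g s.

Section Carry.
Variables (g : 'S_n.+1) (pr : nat -> bool) (K : nat).
Hypothesis pr_lt : forall k, pr k -> (k < K)%N.
Hypothesis Kn : (K <= n)%N.

Definition pass_from k := pass g pr (iota k (K - k)).

Lemma pass_fromS k :
  pass_from k = if pr k then pcomp (sref n.+1 k.+1) (pass_from k.+1) else pass_from k.+1.
Proof.
rewrite /pass_from; case: (ltnP k K) => kK.
  by rewrite (_ : K - k = (K - k.+1).+1)%N //; lia.
have pk : pr k = false by apply/negP => /pr_lt; rewrite ltnNge kK.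
have -> : (K - k = 0)%N by lia.
have -> : (K - k.+1 = 0)%N by lia.
by rewrite pk.
Qed.

Lemma pos_pass_other k i : (i <= n)%N -> i != k -> i != k.+1 ->
  pos (pass_from k) i = pos (pass_from k.+1) i.
Proof.
move=> lin ik ik1; rewrite pass_fromS; case pk: (pr k) => //.
by rewrite pos_sref ?(leq_trans (pr_lt pk) Kn) // (negbTE ik) (negbTE ik1).
Qed.

Lemma pos_pass_lt k i : (i <= n)%N -> (i < k)%N -> pos (pass_from k) i = pos g i.
Proof.
move=> lin; have [m] := ubnP (K - k)%N; elim: m k => // m IH k lem ik.
case: (ltnP k K) => kK; last by rewrite /pass_from (_ : K - k = 0)%N //; lia.
by rewrite pos_pass_other ?IH //; lia.
Qed.

Lemma pos_pass_gt m k : (m <= k)%N -> (k < n)%N ->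
  pos (pass_from m) k.+1 = pos (pass_from k) k.+1.
Proof.
move=> mk kn; have [d] := ubnP (k - m)%N; elim: d m mk => // d IH m mk lem.
have [->//|ne] := eqVneq m k.
by rewrite pos_pass_other; [apply: IH; lia|lia..].
Qed.

(** The value held at position [k] once the letters from [k] on have acted. *)
Definition carry k := pos (pass_from k) k.

Lemma carryE k : (k < n.+1)%N -> carry k = if pr k then carry k.+1 else pos g k.
Proof.
move=> kn; rewrite /carry pass_fromS; case pk: (pr k); last by rewrite pos_pass_lt.
by have [-> _] := pos_sref_swap (pass_from k.+1) (leq_trans (pr_lt pk) Kn).
Qed.

Lemma pos_passS k : (k < n)%N ->
  pos (pass_from 0) k.+1 = if pr k then pos g k else carry k.+1.
Proof.
move=> kn; rewrite (@pos_pass_gt 0 k) // pass_fromS; case pk: (pr k) => //.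
have [_ ->] := pos_sref_swap (pass_from k.+1) kn.
by rewrite pos_pass_lt // ltnW.
Qed.

End Carry.

(** The mask [mv] is indexed by the letters that [m] keeps; [count id (take i m)] is the index there
    of the letter at offset [i]. *)
Lemma wprod_pass m k0 mv g pr :
    (forall i, (i < size m)%N ->
       pr (k0 + i)%N = nth false m i && nth false mv (count id (take i m))) ->
  pcomp (wprod n.+1 (mask mv (mask m (iota k0.+1 (size m))))) g =
  pass g pr (iota k0 (size m)).
Proof.
elim: m k0 mv => [|b m IH] k0 mv H; first by rewrite mask0 /= comp1g.
have pk := H 0%N isT; rewrite addn0 in pk; rewrite [RHS]/= pk.
have HS i : (i < size m)%N -> pr (k0.+1 + i)%N = nth false (b :: m) i.+1 && _ :=
  fun im => etrans (congr1 pr (addSnnS k0 i)) (H i.+1 im).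
case: b pk {H} HS => pk HS; last by rewrite -(IH k0.+1 mv).
case: mv pk HS => [|d mv] pk HS.
  rewrite -(IH k0.+1 [::]); first by rewrite !mask0s.
  by move=> i im; rewrite HS // !nth_nil.
rewrite -(IH k0.+1 mv) //; case: d {pk HS} => //=.
by rewrite pcompA.
Qed.

Lemma ascending_pass m k0 mv g pr :
    (forall i, (i < size m)%N ->
       pr (k0 + i)%N = nth false m i && nth false mv (count id (take i m))) ->
    size mv = count id m ->
    ascending g (mask m (iota k0.+1 (size m))) mv ->
  forall i, (i < size m)%N -> nth false m i ->
    let h := pass g pr (iota (k0 + i).+1 (size m - i.+1)) in
    (len h < len (pcomp (sref n.+1 (k0 + i).+1) h))%N.
Proof.
elim: m k0 mv => [|b m IH] k0 mv H //.
have HS i : (i < size m)%N -> pr (k0.+1 + i)%N = nth false (b :: m) i.+1 && _ :=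
  fun im => etrans (congr1 pr (addSnnS k0 i)) (H i.+1 im).
case: b {H} HS => HS.
  case: mv HS => [|d mv] //= HS [sz] /andP[asc0 asc] [|i] im mi.
    by rewrite addn0 subSS subn0 -(wprod_pass (k0 := k0.+1) (mv := mv)).
  by rewrite -addSnnS subSS; apply: (IH k0.+1 mv).
move=> /= sz asc [|i] //= im mi.
by rewrite -addSnnS subSS; apply: (IH k0.+1 mv).
Qed.

Lemma pos_wprod_fix s q i : all (fun k => k <= q)%N s -> (q < i <= n)%N ->
  pos (wprod n.+1 s) i = inord i.
Proof.
move=> + qi; elim: s => [|[|k] s IH] /=.
- by rewrite /pos invg1 perm1.
- by rewrite sref0 comp1g.
move=> /andP[kq /IH <-]; rewrite pos_sref; try lia.
have /negbTE-> : i != k by lia.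
by have /negbTE-> : i != k.+1 by lia.
Qed.

End Passes.

(** * Factoring the matrix along the word *)

Section WordMatrix.
Variables (n : nat) (R : realFieldType).

Lemma Mword_cons i u mv (a : nat -> R) : Mword n.+1 (i :: u) mv a =
  (if nth false mv 0 then sdot n.+1 R i else xmat n.+1 i (a 0%N)) *m
  Mword n.+1 u (behead mv) (fun j => a j.+1).
Proof.
rewrite /Mword /=; congr (_ *m _); rewrite (iotaDl 1 0) foldr_map.
by elim: (iota 0 _) => //= p s ->; rewrite nth_behead.
Qed.

Lemma Mword_cat u1 u2 m1 m2 (a : nat -> R) : size m1 = size u1 ->
  Mword n.+1 (u1 ++ u2) (m1 ++ m2) a =
  Mword n.+1 u1 m1 a *m Mword n.+1 u2 m2 (fun j => a (size u1 + j)%N).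
Proof.
elim: u1 m1 a => [|i u1 IH] [|b m1] a //= => [_|[sz]].
  by rewrite [Mword _ [::] _ _]/Mword /= mul1mx.
by rewrite !Mword_cons /= IH // mulmxA.
Qed.

Lemma Mword_block m k0 mv (al : nat -> R) pres dot val (N : 'M[R]_n.+1) :
    (forall i, (i < size m)%N -> [/\ pres (k0 + i)%N = nth false m i,
       nth false m i -> dot (k0 + i)%N = nth false mv (count id (take i m)) &
       val (k0 + i)%N = al (count id (take i m))]) ->
  Mword n.+1 (mask m (iota k0.+1 (size m))) mv al *m N =
  foldr (fun i acc => letter_mx n pres dot val i *m acc) N (iota k0 (size m)).
Proof.
elim: m k0 mv al => [|b m IH] k0 mv al H; first by rewrite [Mword _ _ _ _]/Mword /= mul1mx.
have [pk dk vk] := H 0%N isT; rewrite addn0 in pk dk vk.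
have HS i (im : (i < size m)%N) := H i.+1 im.
case: b pk dk vk {H} HS => pk dk vk HS; last first.
  rewrite [RHS]/= /letter_mx pk mul1mx -(IH k0.+1 mv al) // => i im.
  by have := HS i im; rewrite -addSnnS.
rewrite [mask _ _]/= Mword_cons -mulmxA [RHS]/= {1}/letter_mx pk dk // vk; congr (_ *m _).
apply: IH => i im; have := HS i im; rewrite -addSnnS /=.
by rewrite nth_behead.
Qed.

End WordMatrix.

(** * The Gale order by counting *)

Section Gale.
Variables (n : nat) (R : realFieldType).
Implicit Types (I J : {set 'I_n.+1}) (P : {set 'I_n.+1} -> R).

Lemma gale_le_upto I J : #|I| = #|J| ->
  (forall t, (#|upto J t| <= #|upto I t|)%N) -> gale_le I J.
Proof.
move=> eIJ H; rewrite /gale_le eIJ eqxx /= all2E !size_map -!cardE eIJ eqxx /=.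
apply/(all_nthP (0%N, 0%N)) => i; rewrite size_zip !size_map -!cardE eIJ minnn => iJ.
have iI : (i < #|I|)%N by rewrite eIJ.
rewrite nth_zip ?size_map -?cardE //= !(nth_map ord0) -?cardE //.
set s := nth _ _ _; set t := nth _ (enum J) _; rewrite leqNgt; apply/negP => ts.
have cJ := card_upto_above J t; rewrite card_above_nth // in cJ.
have cI := card_upto_above I t.
(* If the entry [t] of [J] were smaller than the entry [s] of [I] at the same rank, [I] would have
   more elements above [t] than [J], against the counting hypothesis. *)
have : (#|s |: above I s| <= #|above I t|)%N.
  apply/subset_leq_card/subsetP => h; rewrite !inE => /orP[/eqP->|/andP[-> sh]].
    by rewrite ts -mem_enum mem_nth // -cardE.
  by rewrite (ltn_trans ts sh).
rewrite cardsU1 inE ltnn andbF /= card_above_nth //.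
move: cI cJ (H t) iJ; rewrite eIJ /=.
by move: #|upto I t| #|above I t| #|upto J t| #|J| => p q p' d; lia.
Qed.

Lemma gale_le_anti I J : gale_le I J -> gale_le J I -> I = J.
Proof.
move=> /andP[/eqP eIJ H1] /andP[_ H2].
have sz : size (enum I) = size (enum J) by rewrite -!cardE.
suff e : enum I = enum J by apply/setP => i; rewrite -mem_enum e mem_enum.
apply: (inj_map val_inj); move: H1 H2; rewrite !all2E => /andP[_ H1] /andP[_ H2].
apply: (@eq_from_nth _ 0%N); rewrite !size_map // => i iI; apply/eqP; rewrite eqn_leq.
have nz s t : size s = size t -> (i < size s)%N ->
    all [pred xy : nat * nat | xy.1 <= xy.2]%N (zip s t) -> (nth 0%N s i <= nth 0%N t i)%N.
  move=> st si /(all_nthP (0%N, 0%N))/(_ i); rewrite size_zip st minnn -st => /(_ si).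
  by rewrite nth_zip.
by rewrite !nz ?size_map // -sz.
Qed.

Lemma gale_min_uniq P k I J : gale_min P k I -> gale_min P k J -> I = J.
Proof.
move=> /and3P[cI PI /forallP mI] /and3P[cJ PJ /forallP mJ].
by apply: gale_le_anti; [move: (mI J)|move: (mJ I)]; rewrite ?cI ?cJ ?PI ?PJ.
Qed.

End Gale.

(** * The identity matrix *)

Section Base.
Variables (n : nat) (R : realFieldType).
Variable x0 : nat -> 'I_n.+1.
Hypothesis x0E : forall i, x0 i = inord i.

Lemma card_initset_inord k : (k <= n.+1)%N -> #|initset x0 k| = k.
Proof.
elim: k => [|k IH] kn; first by rewrite /= cards0.
rewrite /= cardsU1 IH 1?ltnW // (_ : _ \notin _) //.
apply/negP => /in_initset[i ik /(congr1 val)]; rewrite /= !x0E !inordK //; lia.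
Qed.

Lemma above_initset_inord k : (k < n.+1)%N -> above (initset x0 k.+1) (x0 k) = set0.
Proof.
move=> kn; apply/setP => j; rewrite !inE; apply/negP => /andP[].
rewrite -in_setU1 => /(@in_initset _ x0 k.+1)[i ik ->].
by rewrite !x0E !inordK //; lia.
Qed.

Lemma pluck1_expand k (I : {set 'I_n.+1}) : #|I| = k.+1 ->
  pluck (1%:M : 'M[R]_n.+1) I =
  if x0 k \in I then (-1) ^+ #|above I (x0 k)| * pluck (1%:M : 'M[R]_n.+1) (I :\ x0 k) else 0.
Proof.
move=> Ik; rewrite (pluck_expand _ Ik); case: ifP => kI.
  rewrite (bigD1 (x0 k)) //= x0E mxE eqxx mulr1 big1 ?addr0 // => j /andP[_ jk].
  by rewrite mxE eq_sym (negbTE jk) mulr0 mul0r.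
rewrite big1 // => j jI; rewrite mxE (_ : (_ == j) = false) ?mulr0 ?mul0r //.
by apply: contraFF kI => /eqP e; rewrite x0E e.
Qed.

Lemma pluck1_initset k : (k <= n.+1)%N -> pluck (1%:M : 'M[R]_n.+1) (initset x0 k) = 1.
Proof.
elim: k => [|k IH] kn; first exact: pluck0.
rewrite (pluck1_expand (card_initset_inord kn)) above_initset_inord // cards0 mul1r.
have := card_initset_inord kn; rewrite /= cardsU1 card_initset_inord 1?ltnW //.
case xk: (x0 k \in initset x0 k) => /= e; first by lia.
by rewrite setU11 setU1K ?xk // IH // ltnW.
Qed.

Lemma pluck1_support k (I : {set 'I_n.+1}) :
  #|I| = k -> pluck (1%:M : 'M[R]_n.+1) I != 0 -> I = initset x0 k.
Proof.
elim: k I => [|k IH] I Ik; first by move=> _; apply: cards0_eq.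
rewrite (pluck1_expand Ik); case: ifP => kI; last by rewrite eqxx.
rewrite mulf_eq0 negb_or => /andP[_ nz].
rewrite -(setD1K kI) /= -(IH (I :\ x0 k)) //.
by move: Ik; rewrite (cardsD1 (x0 k)) kI add1n => -[].
Qed.

(** The empty word, with v = w = 1: the only nonzero minors are the leading principal ones. *)
Lemma good_base (A : Type) (D : A -> Prop) (a0 : A) :
  good D a0 (fun=> pluck (1%:M : 'M[R]_n.+1)) (fun _ i j => (1%:M : 'M[R]_n.+1) (inord i) j)
    x0 x0.
Proof.
have rowE l (j : 'I_n.+1) : (1%:M : 'M[R]_n.+1) (inord l) j != 0 -> j = x0 l.
  by rewrite mxE; have [<-|_] := eqVneq (inord l) j; rewrite ?eqxx ?x0E.
split => //.
- exact: card_initset_inord.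
- by move=> a l j _ _ /rowE->.
- move=> a l _ ln; rewrite -x0E mxE eqxx (_ : above _ _ = set0) ?cards0 //.
  apply/setP => j; have /setP/(_ j) := above_initset_inord ln; rewrite !inE /=.
  by case: (j \in initset x0 l) => //; rewrite orbT.
- by move=> a l j _ _ /rowE->; exists l.
- by move=> a l _ _ _; rewrite -x0E mxE eqxx oner_eq0.
- by move=> a I t _ /(pluck1_support (erefl _)) {1}->.
- by move=> a I j _ /(pluck1_support (erefl _)) {1}-> /in_initset[i iI ->]; exists i.
- by move=> a k _; apply: pluck1_initset.
Qed.

End Base.

(** * Induction on the blocks *)

Section Main.
Variables (n : nat) (R : realFieldType) (A : Type) (D : A -> Prop) (a0 : A).
Hypothesis Da0 : D a0.

Fixpoint blocks q : seq nat := if q is q'.+1 then iota 1 q ++ blocks q' else [::].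

Lemma blocks_leq q : all (fun k => k <= q)%N (blocks q).
Proof.
elim: q => //= q IH; rewrite all_cat; apply/andP; split.
  by apply/allP => k; rewrite mem_iota; lia.
by apply: sub_all IH => k; apply: leqW.
Qed.

Lemma w0word_blocks : w0word n.+1 = blocks n.
Proof.
rewrite /w0word /=; suff H q m : (q + m = n)%N ->
    flatten [seq iota 1 (n - t) | t <- iota q m] = blocks m by apply: H.
by elim: m q => //= m IH q e; rewrite IH; [rewrite (_ : n - q = m.+1)%N //; lia|lia].
Qed.

Definition flag_matrix u mv (al : nat -> A -> R) a : 'M[R]_n.+1 :=
  Mword n.+1 u mv (fun j => al j a).
Definition flag_pluck u mv al a := pluck (flag_matrix u mv al a).
Definition flag_row u mv al a i (j : 'I_n.+1) := flag_matrix u mv al a (inord i) j.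

Section BlockStep.
Variables (q : nat) (m1 mv1 : bitseq) (u2 : seq nat) (mv2 : bitseq) (al : nat -> A -> R).
Let K := q.+1.
Let u1 := mask m1 (iota 1 K).
Let al2 j := al (size u1 + j)%N.
Let gv := wprod n.+1 (mask mv2 u2).
Let gw := wprod n.+1 u2.
Hypothesis Kn : (K <= n)%N.
Hypothesis sz_m1 : size m1 = K.
Hypothesis sz_mv1 : size mv1 = size u1.
Hypothesis u2_leq : all (fun k => k <= q)%N u2.
Hypothesis asc_w : ascending gw (iota 1 K) m1.
Hypothesis asc_v : ascending gv u1 mv1.
Hypothesis al_neq0 : forall a j, D a -> (j < size u1)%N -> ~~ nth false mv1 j -> al j a != 0.
Hypothesis IH : good D a0 (flag_pluck u2 mv2 al2) (flag_row u2 mv2 al2) (pos gv) (pos gw).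

(** The index in [u1] of the letter at position [k] of the block, hence also the index of its
    parameter. *)
Let idx k := count id (take k m1).
Let pres k := nth false m1 k.
Let dot k := pres k && nth false mv1 (idx k).
Let val k := al (idx k).
Let N a := flag_matrix u2 mv2 al2 a.
Let r a k := block_row pres dot K (fun k => val k a) (N a) k.

Let size_u1 : size u1 = count id m1.
Proof. by rewrite size_mask // size_iota. Qed.

Let pres_lt k : pres k -> (k < K)%N.
Proof. by rewrite -sz_m1; apply: contraLR; rewrite -leqNgt /pres => h; rewrite nth_default. Qed.

Let dot_pres k : dot k -> pres k. Proof. by case/andP. Qed.
Let dot_lt k (dk : dot k) := pres_lt (dot_pres dk).

Let idx_lt k : pres k -> (idx k < size u1)%N.
Proof.
move=> pk; have kK := pres_lt pk; rewrite size_u1 -[in X in (_ < X)%N](cat_take_drop k m1) count_cat.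
by rewrite (drop_nth false) ?sz_m1 //= -/(pres k) pk addnS ltnS leq_addr.
Qed.

Let matrixE a :
  flag_matrix (u1 ++ u2) (mv1 ++ mv2) al a = block_mx_from pres dot K (fun k => val k a) (N a) 0.
Proof.
rewrite /flag_matrix Mword_cat // /u1 -sz_m1 (@Mword_block n R m1 0 mv1 _ pres dot (fun k => val k a)).
  by rewrite /block_mx_from subn0 sz_m1.
move=> i im; rewrite add0n; split=> // mi.
by rewrite /dot /pres mi.
Qed.

Let vE : wprod n.+1 (mask (mv1 ++ mv2) (u1 ++ u2)) = pass_from gv dot K 0.
Proof.
rewrite mask_cat // wprod_cat /u1 -sz_m1 (@wprod_pass n m1 0 mv1 gv dot).
  by rewrite /pass_from subn0 sz_m1.
by move=> i im; rewrite add0n.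
Qed.

(** With the all-true mask in the role of the outer one, the statements on passes apply to w inside
    the full block just as they do to v inside the word of w. *)
Let presE i : (i < size (nseq K true))%N ->
  pres (0 + i)%N = nth false (nseq K true) i && nth false m1 (count id (take i (nseq K true))).
Proof.
rewrite size_nseq => iK; rewrite add0n nth_nseq iK andTb take_nseq 1?ltnW //.
by rewrite count_nseq mul1n.
Qed.

Let iotaK : iota 1 K = mask (nseq K true) (iota 1 (size (nseq K true))).
Proof. by rewrite size_nseq mask_true // size_iota. Qed.

Let wE : wprod n.+1 (u1 ++ u2) = pass_from gw pres K 0.
Proof.
rewrite wprod_cat /u1 iotaK (wprod_pass _ presE) /pass_from subn0.
by rewrite size_nseq.
Qed.

Let asc_dot k : pres k -> (pos gv k < carry gv dot K k.+1)%N.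
Proof.
move=> pk; have kK := pres_lt pk; have kn := leq_trans kK Kn.
have km : (k < size m1)%N by rewrite sz_m1.
have := @ascending_pass n m1 0 mv1 gv dot _ _ _ k km pk.
rewrite add0n sz_m1 -/(pass_from gv dot K k.+1) => H.
rewrite -(@pos_pass_lt n gv dot K _ Kn k.+1) //; last exact: ltnW.
apply: len_lt_pos => //; apply: H => //.
by rewrite sz_mv1.
Qed.

Let asc_pres k : (k.+1 < n.+1)%N -> (pos gw k < carry gw pres K k.+1)%N.
Proof.
move=> kn; case: (ltnP k K) => kK.
  have km : (k < size (nseq K true))%N by rewrite size_nseq.
  have := @ascending_pass n (nseq K true) 0 m1 gw pres presE _ _ k km.
  rewrite add0n size_nseq -/(pass_from gw pres K k.+1) => H.
  rewrite -(@pos_pass_lt n gw pres K _ Kn k.+1) //; last exact: ltnW.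
  apply: len_lt_pos => //; apply: H => //.
  - by rewrite count_nseq mul1n.
  - by rewrite -[X in iota _ X](size_nseq K true) -iotaK.
  - by rewrite nth_nseq kK.
(* After the block nothing is carried, and the later blocks only move positions below [K]. *)
have fix_ i : (K <= i <= n)%N -> pos gw i = inord i.
  by move=> /andP[Ki lin]; apply: (pos_wprod_fix u2_leq); rewrite lin andbT.
rewrite carryE //; have /negbTE-> : ~~ pres k.+1.
  by apply/negP => /pres_lt; rewrite ltnNge leqW.
have lk1 : (k.+1 <= n)%N by [].
by rewrite !fix_ ?kK ?(leqW kK) ?(ltnW lk1) // !inordK // ltnW.
Qed.

Let kn1 k : pres k -> (k.+1 < n.+1)%N.
Proof. by move=> /pres_lt kK; apply: leq_trans kK Kn. Qed.

Lemma block_step_good :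
  good D a0 (flag_pluck (u1 ++ u2) (mv1 ++ mv2) al) (flag_row (u1 ++ u2) (mv1 ++ mv2) al)
    (pos (wprod n.+1 (mask (mv1 ++ mv2) (u1 ++ u2)))) (pos (wprod n.+1 (u1 ++ u2))) /\
  (forall f, monomial D (orbit_coord D a0 (flag_pluck u2 mv2 al2) (pos gv)) f ->
     monomial D (orbit_coord D a0 (flag_pluck (u1 ++ u2) (mv1 ++ mv2) al)
       (pos (wprod n.+1 (mask (mv1 ++ mv2) (u1 ++ u2))))) f) /\
  (forall k, pres k -> ~~ dot k ->
     monomial D (orbit_coord D a0 (flag_pluck (u1 ++ u2) (mv1 ++ mv2) al)
       (pos (wprod n.+1 (mask (mv1 ++ mv2) (u1 ++ u2))))) (val k)).
Proof.
rewrite vE wE.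
have val_neq0 a k : D a -> pres k -> ~~ dot k -> val k a != 0.
  by move=> Da pk; rewrite /dot pk /= => dk; apply: al_neq0 (idx_lt pk) dk.
have bE := carryE gv dot_lt Kn; have cE := carryE gw pres_lt Kn.
have rE a k j (kn : (k < n.+1)%N) : r a k j = if dot k then r a k.+1 j
    else if pres k then flag_row u2 mv2 al2 a k j + val k a * r a k.+1 j
    else flag_row u2 mv2 al2 a k j.
  rewrite /r (block_rowE dot _ _ pres_lt Kn _ kn) -/(r a k.+1 j).
  by rewrite (_ : dot k && pres k = dot k) // /dot andbAC andbb.
have row0 a : flag_row (u1 ++ u2) (mv1 ++ mv2) al a 0 =1 r a 0%N.
  by move=> j; rewrite /flag_row matrixE.
have rowS a k j : (k.+1 < n.+1)%N -> flag_row (u1 ++ u2) (mv1 ++ mv2) al a k.+1 j =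
    if dot k then - flag_row u2 mv2 al2 a k j else r a k.+1 j.
  move=> kn; rewrite /flag_row matrixE (block_rowS dot _ _ pres_lt Kn _ kn).
  by rewrite (_ : dot k && pres k = dot k) // /dot andbAC andbb.
have ex a k (I : {set 'I_n.+1}) : #|I| = k.+1 -> flag_pluck (u1 ++ u2) (mv1 ++ mv2) al a I =
    \sum_(j in I) (-1) ^+ #|above I j| * r a k j * flag_pluck u2 mv2 al2 a (I :\ j).
  by move=> Ik; rewrite /flag_pluck matrixE (block_expand dot _ _ pres_lt Kn Ik).
have p0 a : flag_pluck (u1 ++ u2) (mv1 ++ mv2) al a set0 = 1 by apply: pluck0.
have x0 : pos (pass_from gv dot K 0) 0 = carry gv dot K 0 by [].
have y0 : pos (pass_from gw pres K 0) 0 = carry gw pres K 0 by [].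
have xS := pos_passS gv dot_lt Kn; have yS := pos_passS gw pres_lt Kn.
split; [|split].
- exact: (step_good Da0 IH dot_pres kn1 val_neq0 bE cE rE x0 y0 row0 xS yS rowS
    asc_dot asc_pres ex p0).
- exact: (step_mono Da0 IH dot_pres kn1 val_neq0 bE cE rE x0 xS asc_dot asc_pres ex p0).
- exact: (step_val Da0 IH dot_pres kn1 val_neq0 bE cE rE x0 xS asc_dot asc_pres ex p0).
Qed.

End BlockStep.

Lemma nth_true_count (m : bitseq) j : (j < count id m)%N ->
  exists k, nth false m k /\ count id (take k m) = j.
Proof.
elim: m j => // -[] m IH [|j] //= jm; first by exists 0%N.
  by have [k [mk <-]] := IH j jm; exists k.+1.
  by have [k [mk ck]] := IH 0%N jm; exists k.+1.
by have [k [mk ck]] := IH j.+1 jm; exists k.+1.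
Qed.

Lemma flag_good q mw mv (al : nat -> A -> R) (u := mask mw (blocks q)) :
    (q <= n)%N -> size mw = size (blocks q) -> size mv = size u ->
    ascending (1%g : 'S_n.+1) (blocks q) mw -> ascending (1%g : 'S_n.+1) u mv ->
    (forall a j, D a -> (j < size u)%N -> ~~ nth false mv j -> al j a != 0) ->
  good D a0 (flag_pluck u mv al) (flag_row u mv al)
    (pos (wprod n.+1 (mask mv u))) (pos (wprod n.+1 u)) /\
  forall j, (j < size u)%N -> ~~ nth false mv j ->
    monomial D (orbit_coord D a0 (flag_pluck u mv al) (pos (wprod n.+1 (mask mv u)))) (al j).
Proof.
rewrite {}/u; elim: q mw mv al => [|q IH] mw mv al qn.
  case: mw => //= _ /size0nil-> _ _ _; split=> // .
  have p1 i : pos (1%g : 'S_n.+1) i = inord i by rewrite /pos invg1 perm1.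
  exact: (good_base R p1 D a0).
have bE : blocks q.+1 = iota 1 q.+1 ++ blocks q by [].
rewrite {}bE size_cat size_iota => szw.
rewrite -(cat_take_drop q.+1 mw); set m1 := take _ _; set m2 := drop _ _.
have sz1 : size m1 = q.+1 by rewrite size_takel // szw leq_addr.
have sz1' : size m1 = size (iota 1 q.+1) by rewrite size_iota.
have sz2 : size m2 = size (blocks q) by rewrite size_drop szw addKn.
rewrite (mask_cat _ _ sz1') size_cat; set u1 := mask m1 _; set u2 := mask m2 _ => szv.
rewrite -(cat_take_drop (size u1) mv); set mv1 := take _ mv; set mv2 := drop _ mv.
have szv1 : size mv1 = size u1 by rewrite size_takel // szv leq_addr.
have szv2 : size mv2 = size u2 by rewrite size_drop szv addKn.
rewrite (ascending_cat _ _ _ sz1') (ascending_cat _ _ _ szv1).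
have comp1 (g : 'S_n.+1) : pcomp g 1%g = g by rewrite /Defs.comp mul1g.
rewrite !comp1 => /andP[ascw ascw2] /andP[ascv ascv2] al0.
have al1 a j : D a -> (j < size u1)%N -> ~~ nth false mv1 j -> al j a != 0.
  move=> Da ju vj; apply: al0 => //; first exact: ltn_addr.
  by rewrite nth_cat szv1 ju.
have al2 a j : D a -> (j < size u2)%N -> ~~ nth false mv2 j -> al (size u1 + j)%N a != 0.
  move=> Da ju vj; apply: al0 => //; first by rewrite ltn_add2l.
  by rewrite nth_cat szv1 ltnNge leq_addr /= addKn.
have [g2 mono2] := IH m2 mv2 _ (ltnW qn) sz2 szv2 ascw2 ascv2 al2.
have u2_leq : all (fun k => k <= q)%N u2.
  by apply/allP => k /mem_mask; apply: (allP (blocks_leq q)).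
have [gM [mono_tr mono1]] := block_step_good qn sz1 szv1 u2_leq ascw ascv al1 g2.
split=> // j ju vj; have [ju1|u1j] := ltnP j (size u1).
  have [k [mk ck]] : exists k, nth false m1 k /\ count id (take k m1) = j.
    by apply: nth_true_count; rewrite -(size_mask sz1').
  have := mono1 k mk; rewrite mk ck; apply.
  by move: vj; rewrite nth_cat szv1 ju1.
apply: mono_tr; have := mono2 (j - size u1)%N; rewrite subnKC //; apply.
  by rewrite ltn_subLR.
by move: vj; rewrite nth_cat szv1 ltnNge u1j.
Qed.

End Main.

(** * The extremal indices *)

Section Extremal.
Variables (n : nat) (R : realFieldType) (A : Type) (D : A -> Prop) (a0 : A).
Hypothesis Da0 : D a0.
Variables (P : A -> {set 'I_n.+1} -> R) (row : A -> nat -> 'I_n.+1 -> R).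
Variables (x y : nat -> 'I_n.+1).
Hypothesis gP : good D a0 P row x y.
Hypothesis P0 : forall a, P a set0 = 1.

(** Reachability under [Xi] makes the union of the orbits a finite set; [k] runs from 1 to [n],
    which is one less than the number of columns. *)
Definition extremal_sets : {set {set 'I_n.+1}} :=
  [set I | [exists k : 'I_n.+1, (0 < k)%N && fconnect (Xi (P a0)) (initset x k) I]].

Lemma extremal_setsP I : reflect (exists k t, (0 < k <= n)%N /\ I = orb a0 P x k t)
  (I \in extremal_sets).
Proof.
rewrite inE; apply: (iffP existsP) => [[k /andP[k0 fc]]|[k [t [/andP[k0 kn] ->]]]].
  exists k, (findex (Xi (P a0)) (initset x k) I).
  by rewrite k0 -ltnS ltn_ord /orb iter_findex.
have kn1 : (k < n.+1)%N by [].
by exists (Ordinal kn1); rewrite /= k0 fconnect_iter.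
Qed.

Lemma gale_min_initset a k : D a -> (k <= n.+1)%N -> gale_min (P a) k (initset x k).
Proof.
move=> Da kn; rewrite /gale_min (good_card gP) // eqxx (good_min gP) // oner_eq0 /=.
apply/forallP => J; apply/implyP => /andP[/eqP cJ PJ].
apply: gale_le_upto; first by rewrite (good_card gP).
by move=> t; have := good_Plow gP t Da PJ; rewrite cJ.
Qed.

(** This makes the extremal indices independent of the parameters. *)
Lemma orb_iter a k t : D a -> (k <= n.+1)%N -> orb a0 P x k t = iter t (Xi (P a)) (initset x k).
Proof.
move=> Da kn; elim: t => //= t <-.
exact/esym/(good_Xi gP t Da kn).
Qed.

Lemma extremal_setsE a I : D a -> I \in extremal_sets <-> extremal (P a) I.
Proof.
move=> Da; split.
  move=> /extremal_setsP[k [t [/andP[k0 kn] ->]]]; exists k; split=> //.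
  exists (initset x k); split; first by apply: gale_min_initset => //; apply: leqW.
  by exists t; apply: orb_iter => //; apply: leqW.
move=> [k [k0 kn [Ik [gm [t ->]]]]]; apply/extremal_setsP; exists k, t.
have kn1 : (k <= n.+1)%N by apply: leqW.
rewrite k0 kn (orb_iter _ Da kn1); split=> //.
by rewrite (gale_min_uniq gm (gale_min_initset Da kn1)).
Qed.

Lemma extremal_exponents f : monomial D (orbit_coord D a0 P x) f ->
  exists e : {set 'I_n.+1} -> int, forall a, D a ->
    f a = \prod_(I in extremal_sets) P a I ^ e I.
Proof.
apply: monomial_exponents => [a I Da /extremal_setsP[k [t [/andP[_ kn] ->]]]|g].
  by apply: (orb_neq0 t gP Da); apply: leqW.
move=> [k [t [kn gE]]]; case: (posnP k) => [k0|k0].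
  by left=> a Da; rewrite gE // k0 orb0.
move: kn; rewrite leq_eqVlt => /orP[/eqP kn|kn].
  by left=> a Da; rewrite gE // kn orb_full ?(good_card gP) // (good_min gP).
right; exists (orb a0 P x k t) => //.
by apply/extremal_setsP; exists k, t; rewrite k0.
Qed.

End Extremal.

Theorem theorem3 (R : realFieldType) (n : nat) (v w : 'S_n)
  (mw mv : bitseq) :
  bruhat_le v w ->
  is_pds (w0word n) w mw ->
  is_pds (mask mw (w0word n)) v mv ->
  let u := mask mw (w0word n) in
  exists E : {set {set 'I_n}},
    (forall a : nat -> R, (forall j, ~~ nth false mv j -> 0 < a j) ->
       forall I, I \in E <-> extremal (pluck (Mword n u mv a)) I) /\
    (forall j : nat, (j < size u)%N -> ~~ nth false mv j ->
       exists e : {set 'I_n} -> int,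
         forall a : nat -> R, (forall j', ~~ nth false mv j' -> 0 < a j') ->
           a j = \prod_(I in E) (pluck (Mword n u mv a) I) ^ (e I)).
Proof.
move=> _; case: n v w => [|n] v w pw pv /=.
  (* With no points the word is empty and no [k] satisfies the bounds. *)
  exists set0; split=> [a _ I|j]; last by rewrite mask0.
  by rewrite inE; split=> // -[k [k0 kn]]; move: (leq_trans k0 kn).
pose D (a : nat -> R) := forall j, ~~ nth false mv j -> 0 < a j.
pose al j (a : nat -> R) := a j.
(* Any positive point can serve as the base point of the orbits. *)
have Da0 : D (fun=> 1) by move=> j _; apply: ltr01.
have /andP[/eqP szw _] := pw; have /andP[/eqP szv _] := pv.
have := pds_ascending pv; have := pds_ascending pw.
move: szw szv; rewrite w0word_blocks => szw szv ascw ascv.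
have al0 a j : D a -> (j < size (mask mw (blocks n)))%N -> ~~ nth false mv j -> al j a != 0.
  by move=> Da _ /Da; rewrite lt0r => /andP[].
have [gP mono] := flag_good Da0 (leqnn n) szw szv ascw ascv al0.
have P0 a : flag_pluck (mask mw (blocks n)) mv al a (set0 : {set 'I_n.+1}) = 1 by apply: pluck0.
exists (extremal_sets (fun=> 1) (flag_pluck (mask mw (blocks n)) mv al)
          (pos (wprod n.+1 (mask mv (mask mw (blocks n)))))).
split=> [a Da I|j ju vj]; first exact: (extremal_setsE gP I Da).
exact: (extremal_exponents gP P0 (mono j ju vj)).
Qed.
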